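(* For every $\varepsilon>0$ there is a constant $C_\varepsilon>0$ such that for every $q\in[1,4)$ and every $f\in\mathcal{S}(\mathbb{R})$, $$\|e^{it\Delta}f\|_{L^{4}_{t,x}([-1,1]\times\mathbb{R})}\le C_{\varepsilon}\,\|f\|_{M^{\varepsilon}_{2,q}(\mathbb{R})}.$$
   Context: Fourier transform: $\widehat f(\xi)=\int_{\mathbb{R}^d}e^{-i x\cdot\xi}f(x)\,dx$. For $f\in\mathcal{S}(\mathbb{R}^d)$ the propagator is $e^{it\Delta}f(x):=\frac{1}{(2\pi)^d}\int_{\mathbb{R}^d}e^{i(x\cdot\xi+t|\xi|^2)}\widehat f(\xi)\,d\xi$ (note the sign convention $+t|\xi|^2$). Modulation spaces: fix once and for all $\varphi\in C_0^\infty(\mathbb{R}^d)$ with $\mathrm{supp}\,\varphi\subset[-1,1]^d$ and $\sum_{k\in\mathbb{Z}^d}\varphi(\xi-k)=1$ for all $\xi\in\mathbb{R}^d$. For $k\in\mathbb{Z}^d$ let $\square_k$ be the Fourier multiplier $\widehat{\square_k f}(\xi)=\varphi(\xi-k)\widehat f(\xi)$. Let $\langle k\rangle=(1+|k|^2)^{1/2}$. For $s\in\mathbb{R}$, $p,q\in(0,\infty]$ and $f\in\mathcal{S}'(\mathbb{R}^d)$, $$\|f\|_{M^s_{p,q}(\mathbb{R}^d)}:=\Big\|\langle k\rangle^s\|\square_kf\|_{L^p(\mathbb{R}^d)}\Big\|_{\ell^q_k(\mathbb{Z}^d)}.$$ Here $d=1$. Constants may depend on the fixed window $\varphi$. *)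

(* Defs.v *)
From HB Require Import structures.
From mathcomp Require Import all_boot all_order all_algebra.
From mathcomp Require Import all_classical all_reals all_analysis.
From mathcomp Require Import complex.

Set Implicit Arguments.
Unset Strict Implicit.
Unset Printing Implicit Defensive.

Import Order.TTheory GRing.Theory Num.Theory.
Import numFieldNormedType.Exports.

Local Open Scope classical_set_scope.
Local Open Scope complex_scope.
Local Open Scope ring_scope.

Section Defs.
Context {R : realType}.
Local Notation mu := (@lebesgue_measure R).
Implicit Types (f g phi : R -> R[i]) (p q : \bar R) (s t x xi : R) (k : int).

(* R[i] carries no normed-module structure over R, so differentiation and
   integration of complex-valued functions are componentwise. *)
Definition smooth f : Prop :=
  forall (n : nat) x,
    derivable (derive1n n (@complex.Re R \o f)) x 1 /\
    derivable (derive1n n (@complex.Im R \o f)) x 1.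

Definition cderive1n (n : nat) f : R -> R[i] :=
  fun x => derive1n n (@complex.Re R \o f) x +i* derive1n n (@complex.Im R \o f) x.

Definition cintegral g : R[i] :=
  (\int[mu]_x complex.Re (g x)) +i* (\int[mu]_x complex.Im (g x)).

Definition cabs (z : R[i]) : R := ComplexField.Normc.normc z.

(* e^{i theta} *)
Definition cis (theta : R) : R[i] := cos theta +i* sin theta.

Definition schwartz f : Prop :=
  smooth f /\
  forall m n : nat, exists M : R,
    forall x, `|x| ^+ m * cabs (cderive1n n f x) <= M.

Definition fourier f : R -> R[i] :=
  fun xi => cintegral (fun x => cis (- (x * xi)) * f x).

Definition inv_fourier g : R -> R[i] :=
  fun x => ((2 * pi)^-1)%:C * cintegral (fun xi => cis (x * xi) * g xi).

(* Sign convention: the phase is + t xi^2. *)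
Definition propagator t f : R -> R[i] :=
  fun x => ((2 * pi)^-1)%:C *
    cintegral (fun xi => cis (x * xi + t * xi ^+ 2) * fourier f xi).

(* The sum over Z has at most three nonzero terms because of the support
   condition, so the finitely supported sum is the actual one.  The window may
   be complex-valued. *)
Definition window phi : Prop :=
  [/\ smooth phi,
      closure [set xi | phi xi != 0] `<=` `[-1, 1] &
      forall xi, \sum_(k \in [set: int]) phi (xi - k%:~R) = 1].

Definition box phi k f : R -> R[i] :=
  inv_fourier (fun xi => phi (xi - k%:~R) * fourier f xi).

Definition japanese_bracket k : R := Num.sqrt (1 + k%:~R ^+ 2).

(* Meant for q in ]0, +oo]; same shape as Lnorm, but int carries no
   measurable structure for the counting measure. *)
Definition lnormZ q (a : int -> \bar R) : \bar R :=
  match q with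
  | r%:E => (\esum_(k in [set: int]) `|a k| `^ r) `^ r^-1
  | +oo => ereal_sup (range (abse \o a))
  | -oo => 0
  end%E.

(* Meant for p, q in ]0, +oo] and Schwartz f. *)
Definition modulation_norm phi s p q f : \bar R :=
  lnormZ q (fun k => (japanese_bracket k `^ s)%:E *
                     Lnorm mu p (fun x => (cabs (box phi k f x))%:E))%E.

(* The L^p norm of u over [-1,1] x R, the first variable being time. *)
Definition spacetime_norm p (u : R -> R -> R[i]) : \bar R :=
  Lnorm (mu \x mu)%E p
    ((fun tx : R * R => (cabs (u tx.1 tx.2))%:E) \_ (`[-1, 1] `*` setT)).

End Defs.

(* Main.v *)
Require Import Defs.
From HB Require Import structures.
From mathcomp Require Import all_boot all_order all_algebra.
From mathcomp Require Import all_classical all_reals all_analysis.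
From mathcomp Require Import measurable_realfun.
From mathcomp Require Import complex ring lra zify.
Import Order.TTheory GRing.Theory Num.Theory.
Import numFieldNormedType.Exports.
Local Open Scope classical_set_scope.
Local Open Scope ring_scope.
Set Implicit Arguments.
Unset Strict Implicit.
Unset Printing Implicit Defensive.

(** With g the Fourier transform of f, the square of e^{it Delta} f at time t is an
   inverse Fourier transform in s of the integral over xi of
   e^{it(xi^2 + (s - xi)^2)} g(xi) g(s - xi).  Plancherel in x and then an L^2 bound
   in t, for the weight e^{-|t|} and the phase xi^2 + (s - xi)^2, give
     int int_{|t| <= 1} |e^{it Delta} f|^4
       <= C int int |g(xi)|^2 |g(eta)|^2 / (1 + (xi - eta)^2)^{1/2} dxi deta.
   The L^2 bounds come from e^{-d|x|} having Fourier transform 2d / (d^2 + u^2): the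
   weighted L^2 norm of int e^{i x th(s)} G(s) ds is a quadratic form with kernel
   2d / (d^2 + (th(s) - th(r))^2), to which the Schur test applies, and Plancherel is
   the limit d -> 0 for th = id.
   Cutting g into unit frequency boxes, with beta_j the squared L^2 norm of box j of g,
   bounds the right-hand side by sum_{j,l} beta_j beta_l / <j - l>.  As
   <l>^{-2 eps} / <j - l> is summable in l uniformly in j, Schur's test bounds this by
   C_eps sum_j <j>^{4 eps} beta_j^2, and the embedding of l^q in l^4 concludes with a
   constant independent of q. *)

(** * Poisson and exponential kernels *)

Section translation.
Context {R : realType}.
Local Notation mu := (@lebesgue_measure R).

(** The exponent 4 is even, so the L^4 norm is the L^2 norm of a square and neither interpolation
    nor duality enters. The sum of 1/<j - l> over l diverges logarithmically; the weight <k>^eps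
    pays for this, and the price is the factor 1 + 1/eps. The weight e^{-|t|} replaces the indicator
    of [-1,1] because its transform is a positive kernel, fit for Schur's test, and it costs only a
    factor e. Plancherel is needed as two inequalities with different hypotheses: an upper bound for
    the self-convolution, of which only integrability is known, and a lower bound for each box,
    where boundedness, compact support and a Lipschitz bound control the error. No Fourier inversion
    enters, since the propagator and the boxes are both defined from the Fourier transform of f. The
    window may be complex, so g is not compared with its boxes through positivity: at most three of
    them overlap, and Cauchy-Schwarz gives |g|^2 <= 3 sum |box|^2. The final constant is (864 e (1 +
    1/eps))^{1/4} with 864 = 27 * 8 * 4; it depends on neither q nor the window. *)

Lemma lebesgue_measure_shift (a : R) (A : set R) : measurable A ->
  pushforward mu (+%R a : _ -> measurableTypeR R) A = mu A.
Proof.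
move=> mA; apply/esym/lebesgue_measure_unique => //=.
  exact: measurable_funD.
move=> ? _ [[b c]] _ <-.
rewrite /pushforward.
have -> : +%R a @^-1` [set` `]b, c]] = [set` `](b - a), (c - a)]].
  by apply/seteqP; split => x /=; rewrite !in_itv/= lerBrDl ltrBlDl.
rewrite /= !lebesgue_measure_itv/= !lte_fin ltrD2r -!EFinD.
by case: ifPn => // _; congr (_%:E); ring.
Qed.

Lemma ge0_integral_isometry (h : R -> R) (f : R -> \bar R) :
  measurable_fun setT h ->
  (forall A, measurable A -> pushforward mu (h : _ -> measurableTypeR R) A = mu A) ->
  measurable_fun setT f -> (forall x, 0 <= f x)%E ->
  (\int[mu]_x f (h x) = \int[mu]_x f x)%E.
Proof.
move=> mh hE mf f0.
rewrite -(preimage_setT h) -[LHS](@ge0_integral_pushforward _ _ (measurableTypeR R)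
  (measurableTypeR R) R h mh)//=.
by apply: eq_measure_integral => A mA _; exact: hE.
Qed.

Lemma ge0_integral_shift (a : R) (f : R -> \bar R) :
  measurable_fun setT f -> (forall x, 0 <= f x)%E ->
  (\int[mu]_x f (a + x)%R = \int[mu]_x f x)%E.
Proof.
apply: ge0_integral_isometry; first exact: measurable_funD.
exact: lebesgue_measure_shift.
Qed.

Lemma ge0_integral_opp (f : R -> \bar R) :
  measurable_fun setT f -> (forall x, 0 <= f x)%E ->
  (\int[mu]_x f (- x)%R = \int[mu]_x f x)%E.
Proof.
apply: ge0_integral_isometry; first exact: oppr_measurable.
exact: lebesgue_measureN.
Qed.

End translation.

Section kernels.
Context {R : realType}.
Local Notation mu := (@lebesgue_measure R).

(** Two integrands, because [f] may contain [|x|] and have no derivative at 0: [h] agrees with it on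
    the half-line and has a primitive on all of R, so that the fundamental theorem of calculus
    applies up to the endpoint 0. *)
Lemma ge0_integral_even (f h F : R -> R) (l : R) :
  (forall x, 0 <= f x) -> continuous f -> (forall x, f (- x) = f x) ->
  (forall x, 0 <= h x) -> continuous h -> (forall x, 0 <= x -> f x = h x) ->
  (forall x, derivable F x 1 /\ derive1 F x = h x) -> F x @[x --> +oo] --> l ->
  (\int[mu]_x (f x)%:E = (2 * (l - F 0))%:E)%E.
Proof.
move=> f0 cf fN h0 ch fh dFE Fl.
have dF x : derivable F x 1 by case: (dFE x).
rewrite (@ge0_symfun_integralT R) //; last by move=> x /=; rewrite fN.
rewrite -set_itvcy EFinM; congr (_ * _)%E.
transitivity (\int[mu]_(x in `[0%R, +oo[) (h x)%:E)%E.
  apply: eq_integral => x; rewrite inE/= in_itv/= andbT => x0.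
  by rewrite fh.
rewrite (@ge0_continuous_FTC2y R h F 0 l)//.
- exact: continuous_subspaceT.
- apply: cvg_at_right_filter; apply: differentiable_continuous.
  exact/derivable1_diffP/dF.
- by move=> x _; case: (dFE x).
Qed.

(** Fourier transform of [e^{-d|x|}], that is 2 pi times the normalised Poisson kernel: the total
    mass is 2 pi for every [d > 0]. At [d = 1] it is 2/(1 + x^2), which serves throughout as the
    integrable majorant. *)
Definition poisson (d x : R) := 2 * d / (d ^+ 2 + x ^+ 2).

Lemma poisson_den_gt0 (d x : R) : 0 < d -> 0 < d ^+ 2 + x ^+ 2.
Proof. by move=> d0; rewrite ltr_pwDl// ?exprn_gt0// sqr_ge0. Qed.

Lemma poisson_gt0 (d x : R) : 0 < d -> 0 < poisson d x.
Proof. by move=> d0; rewrite divr_gt0 ?mulr_gt0// poisson_den_gt0. Qed.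

Lemma poissonN (d x : R) : poisson d (- x) = poisson d x.
Proof. by rewrite /poisson sqrrN. Qed.

Lemma poisson_le (d x : R) : 0 < d -> poisson d x <= 2 / d.
Proof.
move=> d0; rewrite ler_pdivrMr ?poisson_den_gt0// mulrAC ler_pdivlMr// -mulrA ler_pM2l//.
by rewrite -expr2 lerDl sqr_ge0.
Qed.

Lemma continuous_poisson (d : R) : 0 < d -> continuous (poisson d).
Proof.
move=> d0 x; apply: cvgM; first exact: cvg_cst.
apply: cvgV; first by rewrite gt_eqF// poisson_den_gt0.
apply: cvgD; first exact: cvg_cst.
exact: exprn_continuous.
Qed.

Lemma integral_poisson (d : R) : 0 < d ->
  (\int[mu]_x (poisson d x)%:E = (2 * pi)%:E)%E.
Proof.
move=> d0; rewrite (@ge0_integral_even _ (poisson d) (fun x => 2 * atan (d^-1 * x)) pi)//.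
- by rewrite mulr0 atan0 mulr0 subr0.
- by move=> x; rewrite ltW// poisson_gt0.
- exact: continuous_poisson.
- by move=> x; rewrite poissonN.
- by move=> x; rewrite ltW// poisson_gt0.
- exact: continuous_poisson.
- move=> x.
  have -> : poisson d x = 2 * ((1 + (d^-1 * x) ^+ 2)^-1 * d^-1).
    by rewrite /poisson; field; rewrite !gt_eqF// poisson_den_gt0.
  have H : is_derive x (1 : R) (fun x : R => d^-1 * x) d^-1.
    by apply: is_derive_eq; rewrite -mulr_algr /GRing.scale/= mul1r mulr1.
  have H2 := @is_derive1_comp _ (@atan R) (fun x : R => d^-1 * x) x _ _ (is_derive1_atan _) H.
  have [H3 H4] := @is_deriveZ _ _ _ _ 2 _ _ _ H2.
  by rewrite derive1E; split; [exact: H3|exact: H4].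
- have -> : (pi : R) = 2 * (pi / 2) by field.
  apply: cvgMr; apply: (cvg_comp (fun x : R => d^-1 * x) (@atan R) _ (@cvgy_atan R)).
  by apply: gt0_cvgMry; [rewrite invr_gt0|exact: cvg_id].
Qed.

End kernels.

Section exponential_kernel.
Context {R : realType}.
Local Notation mu := (@lebesgue_measure R).

Let is_derive_scale (u x : R) : is_derive x (1 : R) (fun x : R => u * x) u.
Proof. by apply: is_derive_eq; rewrite /GRing.scale/= mulr1. Qed.

Let exp_primitive (d u x : R) : d != 0 -> d ^+ 2 + u ^+ 2 != 0 ->
  is_derive x (1 : R)
    (fun x => expR (- d * x) * (u / (d ^+ 2 + u ^+ 2) * sin (u * x) -
      d / (d ^+ 2 + u ^+ 2) * cos (u * x) - d^-1))
    (expR (- d * x) * (1 + cos (u * x))).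
Proof.
move=> d0 D0.
have HE := @is_derive1_comp _ (@expR R) (fun x : R => - d * x) x _ _
  (is_derive_expR _) (is_derive_scale (- d) x).
have HS := @is_derive1_comp _ (@sin R) (fun x : R => u * x) x _ _
  (is_derive_sin _) (is_derive_scale u x).
have HC := @is_derive1_comp _ (@cos R) (fun x : R => u * x) x _ _
  (is_derive_cos _) (is_derive_scale u x).
have HB := is_deriveB (is_deriveB (is_deriveZ (u / (d ^+ 2 + u ^+ 2)) HS)
   (is_deriveZ (d / (d ^+ 2 + u ^+ 2)) HC)) (is_derive_cst d^-1 x (1 : R)).
apply: is_derive_eq (is_deriveM HE HB) _.
transitivity (expR (- d * x) * (u / (d ^+ 2 + u ^+ 2) * (cos (u * x) * u) -
   d / (d ^+ 2 + u ^+ 2) * (- sin (u * x) * u) - 0) +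
  (u / (d ^+ 2 + u ^+ 2) * sin (u * x) - d / (d ^+ 2 + u ^+ 2) * cos (u * x) - d^-1) *
  (expR (- d * x) * - d)) => //; field.
by rewrite D0 d0.
Qed.

(** The 1 added to the cosine makes the integrand nonnegative, so that the improper integral can be
    evaluated from a primitive before integrability is known. The case [u = 0] gives the integral of
    the weight alone, which is subtracted afterwards. *)
Lemma integral_expR_1cos (d u : R) : 0 < d ->
  (\int[mu]_x (expR (- d * `|x|) * (1 + cos (x * u)))%:E =
   (2 / d + 2 * d / (d ^+ 2 + u ^+ 2))%:E)%E.
Proof.
move=> d0.
have D0 : d ^+ 2 + u ^+ 2 != 0.
  by rewrite gt_eqF// ltr_pwDl// ?exprn_gt0// sqr_ge0.
pose F x := expR (- d * x) * (u / (d ^+ 2 + u ^+ 2) * sin (u * x) -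
      d / (d ^+ 2 + u ^+ 2) * cos (u * x) - d^-1).
have cexp (g : R -> R) : continuous g -> continuous (fun x => expR (- d * g x) : R).
  move=> cg x; apply: (@continuous_comp _ _ _ (fun x => - d * g x) (@expR R)).
    by apply: cvgMr; exact: cg.
  exact: continuous_expR.
have ccos : continuous (fun x : R => 1 + cos (x * u)).
  move=> x; apply: cvgD; first exact: cvg_cst.
  apply: (@continuous_comp _ _ _ (fun x : R => x * u) (@cos R)).
    by apply: cvgMl; exact: cvg_id.
  exact: continuous_cos.
have pos x : 0 <= 1 + cos (x * u) by rewrite -lerBlDl sub0r cos_geN1.
rewrite (@ge0_integral_even _ _ (fun x => expR (- d * x) * (1 + cos (x * u))) F 0).
- congr (_%:E); rewrite /F !mulr0 expR0 sin0 cos0; field.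
  by rewrite D0 gt_eqF.
- by move=> x; rewrite mulr_ge0// expR_ge0.
- by move=> x; apply: cvgM; [exact/cexp/norm_continuous|exact: ccos].
- by move=> x; rewrite normrN (mulNr x) cosN.
- by move=> x; rewrite mulr_ge0// expR_ge0.
- move=> x; apply: cvgM; [|exact: ccos].
  by apply: cexp => y; exact: cvg_id.
- by move=> x x0; rewrite ger0_norm.
- move=> x; have [H3 H4] := @exp_primitive d u x (lt0r_neq0 d0) D0.
  by rewrite derive1E; split; [exact: H3|rewrite [LHS]H4 (mulrC u)].
- pose M : R := `|u / (d ^+ 2 + u ^+ 2)| + `|d / (d ^+ 2 + u ^+ 2)| + `|d^-1|.
  have FM x : `|F x| <= M * expR (- d * x).
    rewrite /F normrM mulrC (ger0_norm (expR_ge0 _)) ler_wpM2r ?expR_ge0//.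
    rewrite (le_trans (ler_normB _ _))// lerD2r.
    rewrite (le_trans (ler_normB _ _))// !normrM lerD//.
      by rewrite ler_piMr// ?mulr_ge0// sin_max.
    by rewrite ler_piMr// ?mulr_ge0// cos_max.
  have lim0 (c : R) : c * expR (- d * x) @[x --> +oo] --> (0 : R).
    rewrite -[X in _ --> X](mulr0 c); apply: cvgMr.
    under eq_fun do rewrite mulNr.
    apply: (cvg_comp (fun x : R => d * x) (fun x => expR (- x)) _ (@cvgr_expR R)).
    by apply: gt0_cvgMry => //; exact: cvg_id.
  apply: (@squeeze_cvgr _ _ _ _ (fun x => - M * expR (- d * x))
    (fun x => M * expR (- d * x))); [|exact: lim0|exact: lim0].
  by apply: nearW => x; rewrite mulNr -ler_norml.
Qed.

Let continuous_weight (d : R) : continuous (fun x : R => expR (- d * `|x|)).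
Proof.
move=> x; apply: (@continuous_comp _ _ _ (fun x : R => - d * `|x|) (@expR R)).
  by apply: cvgMr; exact: norm_continuous.
exact: continuous_expR.
Qed.

Lemma measurable_expRN_norm (d : R) :
  measurable_fun setT (fun x : R => expR (- d * `|x|)).
Proof. apply: continuous_measurable_fun; exact: continuous_weight. Qed.

Lemma integrable_expRN_norm (d : R) : 0 < d ->
  mu.-integrable setT (EFin \o (fun x : R => expR (- d * `|x|))).
Proof.
move=> d0.
apply: (@le_integrable _ _ _ mu _ measurableT _
  (EFin \o (fun x : R => expR (- d * `|x|) * (1 + cos (x * 0))))).
- apply/measurable_EFinP; exact: measurable_expRN_norm.
- move=> x _; rewrite /= mulr0 cos0 lee_fin normrM ler_peMr//.
  by rewrite ger0_norm; lra.
- apply/integrableP; split.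
    apply/measurable_EFinP; apply: measurable_realfun.measurable_funM.
      exact: measurable_expRN_norm.
    by under eq_fun do rewrite mulr0; exact: measurable_cst.
  rewrite (_ : integral _ _ _ = (2 / d + 2 * d / (d ^+ 2 + 0 ^+ 2))%:E) ?ltry//.
  rewrite -integral_expR_1cos//; apply: eq_integral => x _ /=.
  by rewrite ger0_norm// mulr_ge0// ?expR_ge0// mulr0 cos0; lra.
Qed.

Lemma bounded_integrable_expRN_norm (d : R) (g : R -> R) : 0 < d ->
  measurable_fun setT g -> (forall x, `|g x| <= 1) ->
  mu.-integrable setT (EFin \o (fun x : R => expR (- d * `|x|) * g x)).
Proof.
move=> d0 mg g1.
apply: le_integrable (integrable_expRN_norm d0) => //.
  apply/measurable_EFinP; apply: measurable_realfun.measurable_funM => //.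
  exact: measurable_expRN_norm.
by move=> x _; rewrite /= lee_fin normrM ler_piMr.
Qed.

Lemma measurable_cosM (u : R) : measurable_fun setT (fun x : R => cos (x * u)).
Proof.
apply: measurableT_comp; last exact: mulrr_measurable.
apply: continuous_measurable_fun; exact: continuous_cos.
Qed.

Lemma measurable_sinM (u : R) : measurable_fun setT (fun x : R => sin (x * u)).
Proof.
apply: measurableT_comp; last exact: mulrr_measurable.
apply: continuous_measurable_fun; exact: continuous_sin.
Qed.

Lemma integral_expR_cos (d u : R) : 0 < d ->
  \int[mu]_x (expR (- d * `|x|) * cos (x * u)) = poisson d u.
Proof.
move=> d0.
have H v : \int[mu]_x (expR (- d * `|x|)) + \int[mu]_x (expR (- d * `|x|) * cos (x * v))
    = 2 / d + 2 * d / (d ^+ 2 + v ^+ 2).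
  rewrite -RintegralD//=; last 2 first.
    exact: integrable_expRN_norm.
    apply: bounded_integrable_expRN_norm => //; first exact: measurable_cosM.
    by move=> x; exact: cos_max.
  rewrite /Rintegral.
  under eq_integral do rewrite -{1}(mulr1 (expR _)) -mulrDr.
  by rewrite integral_expR_1cos.
have J : \int[mu]_x (expR (- d * `|x|)) = 2 / d.
  have := H 0; under [X in _ + X]eq_Rintegral do rewrite mulr0 cos0 mulr1.
  have -> : 2 * d / (d ^+ 2 + 0 ^+ 2) = 2 / d.
    by rewrite expr0n/= addr0; field; rewrite gt_eqF.
  by move=> ?; lra.
by have := H u; rewrite J => /addrI.
Qed.

(** The integrand is odd: reflection exchanges its positive and negative parts, whose integrals are
    finite and cancel. *)
Lemma integral_expR_sin (d u : R) : 0 < d ->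
  \int[mu]_x (expR (- d * `|x|) * sin (x * u)) = 0.
Proof.
move=> d0.
pose f x : R := expR (- d * `|x|) * sin (x * u).
have mf : measurable_fun setT f.
  apply: measurable_realfun.measurable_funM; first exact: measurable_expRN_norm.
  exact: measurable_sinM.
have fi : mu.-integrable setT (EFin \o f).
  apply: bounded_integrable_expRN_norm => //; first exact: measurable_sinM.
  by move=> x; exact: sin_max.
suff : (\int[mu]_x (f x)%:E = 0)%E by rewrite /Rintegral => ->.
rewrite integralE.
rewrite -(@ge0_integral_opp _ (EFin \o f)^\+%E)//; last first.
  by apply: measurable_funepos; exact/measurable_EFinP.
rewrite (_ : (\int[mu]_x _ (- x)%R = \int[mu]_x ((EFin \o f)^\- x))%E); last first.
  apply: eq_integral => x _.
  by rewrite unlock [in RHS]unlock /= /f normrN (mulNr x) sinN mulrN EFinN.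
by rewrite subee// (integrable_neg_fin_num measurableT).
Qed.

End exponential_kernel.

(** Measurability by the syntax of the expression. A hypothesis on [h] serves for [h] itself and for
    [h] composed with a subexpression, which is why proofs put such facts in the context before
    calling it. *)
Ltac mfun := repeat match goal with
  | H : measurable_fun setT ?h |- measurable_fun _ ?h => exact: H
  | |- measurable_fun _ fst => exact: measurable_fst
  | |- measurable_fun _ snd => exact: measurable_snd
  | |- measurable_fun _ (fun _ => ?c) => exact: measurable_cst
  | |- measurable_fun _ (fun x => x) => exact: measurable_id
  | |- measurable_fun _ (fun x => fst (@?g x)) => apply: (measurableT_comp measurable_fst)
  | |- measurable_fun _ (fun x => snd (@?g x)) => apply: (measurableT_comp measurable_snd)
  | |- measurable_fun _ (fun x => @?f x + @?g x) =>
      apply: (@measurable_realfun.measurable_funD _ _ _ _ f g)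
  | |- measurable_fun _ (+%R ?c) =>
      apply: (@measurable_realfun.measurable_funD _ _ _ _ (fun _ => c) id)
  | |- measurable_fun _ ( *%R ?c) => exact: mulrl_measurable
  | |- measurable_fun _ id => exact: measurable_id
  | |- measurable_fun _ (fun x => - @?f x) =>
      apply: (@measurable_realfun.measurable_funN _ _ _ _ f)
  | |- measurable_fun _ (fun x => @?f x * @?g x) =>
      apply: (@measurable_realfun.measurable_funM _ _ _ _ f g)
  | |- measurable_fun _ (fun x => @?f x ^+ ?n) =>
      apply: (@measurable_realfun.measurable_funX _ _ _ _ f n)
  | |- measurable_fun _ (poisson _) =>
      by apply: continuous_measurable_fun; exact: continuous_poisson
  | |- measurable_fun _ (fun x => poisson ?d (@?g x)) =>
      apply: (@measurableT_comp _ _ _ _ _ _ (poisson d)); first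
        by [apply: continuous_measurable_fun; exact: continuous_poisson]
  | |- measurable_fun _ (fun x => cos (@?g x)) =>
      apply: (@measurableT_comp _ _ _ _ _ _ cos); first
        by [apply: continuous_measurable_fun; exact: continuous_cos]
  | |- measurable_fun _ (fun x => sin (@?g x)) =>
      apply: (@measurableT_comp _ _ _ _ _ _ sin); first
        by [apply: continuous_measurable_fun; exact: continuous_sin]
  | |- measurable_fun _ (fun x => expR (@?g x)) =>
      apply: (@measurableT_comp _ _ _ _ _ _ expR); first exact: measurable_expR
  | |- measurable_fun _ (fun x => `|@?g x|) =>
      apply: (measurableT_comp (@normr_measurable _ setT))
  | H : measurable_fun setT ?h |- measurable_fun _ (fun x => ?h (@?g x)) =>
      apply: (@measurableT_comp _ _ _ _ _ _ h); first exact: H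
  end.

(** * Integrals with a parameter and integrals over products *)

Lemma EFin_Rintegral d (T : measurableType d) (R : realType)
    (m : {measure set T -> \bar R}) (f : T -> R) :
  m.-integrable setT (EFin \o f) ->
  ((\int[m]_x f x)%:E = \int[m]_x (f x)%:E)%E.
Proof. by move=> fi; rewrite /Rintegral fineK// integrable_fin_num. Qed.

Section products.
Context d1 d2 (T1 : measurableType d1) (T2 : measurableType d2) (R : realType).
Variables (m1 : {sigma_finite_measure set T1 -> \bar R})
  (m2 : {sigma_finite_measure set T2 -> \bar R}).

(** Tonelli for the positive and negative parts; [fine] gives the integral a value at every [x], so
    measurability is obtained without integrability of the sections. *)
Lemma measurable_Rintegral (f : T1 * T2 -> R) : measurable_fun setT f ->
  measurable_fun setT (fun x => \int[m2]_y f (x, y)).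
Proof.
move=> mf.
apply: (@measurableT_comp _ _ _ _ _ _ fine).
  exact: fine_measurable.
have mF : measurable_fun setT (EFin \o f) by exact/measurable_EFinP.
rewrite (_ : (fun x => _) =
  (fubini_F m2 (EFin \o f)^\+%E \- fubini_F m2 (EFin \o f)^\-%E)%E); last first.
  apply/funext => x; rewrite integralE/=.
  by congr (_ - _)%E; apply: eq_integral => y _; rewrite !unlock.
apply: emeasurable_funB.
  apply: (measurable_fun_fubini_tonelli_F (EFin \o f)^\+%E) => //.
  exact: measurable_funepos.
apply: (measurable_fun_fubini_tonelli_F (EFin \o f)^\-%E) => //.
exact: measurable_funeneg.
Qed.

Lemma integrable_prod (a : T1 -> R) (b : T2 -> R) :
  m1.-integrable setT (EFin \o a) -> m2.-integrable setT (EFin \o b) ->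
  (m1 \x m2)%E.-integrable setT (EFin \o (fun z => a z.1 * b z.2)).
Proof.
move=> ia ib.
have ma : measurable_fun setT a by exact/measurable_EFinP/(measurable_int m1).
have mb : measurable_fun setT b by exact/measurable_EFinP/(measurable_int m2).
apply/integrable12ltyP.
  by apply/measurable_EFinP; mfun.
rewrite (_ : integral _ _ _ = (\int[m1]_x (`|a x|%:E * \int[m2]_y `|b y|%:E))%E); last first.
  apply: eq_integral => x _; rewrite -ge0_integralZl//.
    by apply: eq_integral => y _ /=; rewrite normrM.
  by apply/measurable_EFinP; mfun.
have [_ ia1] := integrableP _ _ _ ia.
have [_ ib1] := integrableP _ _ _ ib.
rewrite ge0_integralZr//; last 2 first.
  by apply/measurable_EFinP; mfun.
  exact: integral_ge0.
by rewrite lte_mul_pinfty// ?integral_ge0// ge0_fin_numE ?integral_ge0.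
Qed.

Lemma Rintegral_prod (a : T1 -> R) (b : T2 -> R) :
  m1.-integrable setT (EFin \o a) -> m2.-integrable setT (EFin \o b) ->
  (\int[m1]_x a x) * (\int[m2]_y b y) = \int[(m1 \x m2)%E]_z (a z.1 * b z.2).
Proof.
move=> ia ib; have iab := integrable_prod ia ib.
rewrite [RHS]/Rintegral -(@integral12_prod_meas1 _ _ _ _ _ m1 m2 _ iab).
rewrite /fubini_F /=.
rewrite (_ : (\int[m1]_x _ = \int[m1]_x ((a x)%:E * (\int[m2]_y b y)%:E))%E); last first.
  apply: eq_integral => x _.
  under eq_integral do rewrite EFinM.
  by rewrite integralZl// /Rintegral fineK// integrable_fin_num.
rewrite integralZr// -/(Rintegral _ _ _) /Rintegral.
by rewrite -[X in (X * _)%E](@fineK R) ?integrable_fin_num.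
Qed.

End products.

Section lebesgue_plane.
Context {R : realType}.
Local Notation mu := (@lebesgue_measure R).

(* The library attaches a sigma-finite structure to products only through their
   subprobability instance; this copy of the product carries the general one. *)
Definition lebesgue_plane : set (measurableTypeR R * measurableTypeR R) -> \bar R :=
  (mu \x mu)%E.

HB.instance Definition _ := Measure.on lebesgue_plane.

Let lebesgue_plane_sigma_finite : sigma_finite setT lebesgue_plane.
Proof.
have /sigma_finiteP[F [TF ndF Foo]] := @sigma_finiteT _ _ _ mu.
exists (fun n => F n `*` F n).
  rewrite -setXTT TF predeqE => -[x y]; split.
    move=> [/= [n _ Fnx] [k _ Fky]]; exists (maxn n k) => //; split.
      by move: x Fnx; exact/subsetPset/ndF/leq_maxl.
    by move: y Fky; exact/subsetPset/ndF/leq_maxr.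
  by move=> [n _ []/= ? ?]; split; exists n.
move=> k; have [? ?] := Foo k.
split; first exact: measurableX.
by rewrite [X in (X < _)%E]product_measure1E// lte_mul_pinfty// ge0_fin_numE.
Qed.

HB.instance Definition _ := Measure_isSigmaFinite.Build _ _ _ lebesgue_plane
  lebesgue_plane_sigma_finite.

End lebesgue_plane.

(** * Plancherel for a general phase *)

Section oscillatory.
Context {R : realType}.
Local Notation mu := (@lebesgue_measure R).
Local Notation mu2 := (mu \x mu)%E.
Variables (th u v : R -> R) (d : R).
Hypotheses (mth : measurable_fun setT th) (d0 : 0 < d)
  (iu : mu.-integrable setT (EFin \o u)) (iv : mu.-integrable setT (EFin \o v)).

Let mu' : measurable_fun setT u.
Proof. by have /measurable_int/measurable_EFinP := iu. Qed.
Let mv : measurable_fun setT v.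
Proof. by have /measurable_int/measurable_EFinP := iv. Qed.

(* Complex-valued functions are carried as pairs of real ones: [osc_re] and [osc_im]
   are the components of [int e^{i x th(s)} (u + i v)(s) ds]. *)
Definition osc_re (x : R) := \int[mu]_s (cos (x * th s) * u s - sin (x * th s) * v s).
Definition osc_im (x : R) := \int[mu]_s (sin (x * th s) * u s + cos (x * th s) * v s).
(** Real part of [G(s)] times the conjugate of [G(r)], with [G = u + i v], weighted by the kernel.
    The imaginary part is multiplied by a sine, odd in [x], and integrates to 0 against the even
    weight. *)
Definition poisson_form (z : R * R) :=
  (u z.1 * u z.2 + v z.1 * v z.2) * poisson d (th z.1 - th z.2).

Let integrable_bounded (c w : R -> R) : measurable_fun setT c -> (forall x, `|c x| <= 1) ->
  mu.-integrable setT (EFin \o w) -> mu.-integrable setT (EFin \o (fun x : R => c x * w x)).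
Proof.
move=> mc c1 iw.
have mw : measurable_fun setT w by have /measurable_int/measurable_EFinP := iw.
apply: le_integrable iw => //.
  by apply/measurable_EFinP; mfun.
by move=> x _ /=; rewrite lee_fin normrM ler_piMl.
Qed.

Lemma integrable_osc_re (x : R) :
  mu.-integrable setT (EFin \o (fun s : R => cos (x * th s) * u s - sin (x * th s) * v s)).
Proof.
apply: (@integrableB _ _ _ mu setT measurableT
  (EFin \o (fun s : R => cos (x * th s) * u s)) (EFin \o (fun s : R => sin (x * th s) * v s))).
  by apply: integrable_bounded => //; [mfun|move=> s; exact: cos_max].
by apply: integrable_bounded => //; [mfun|move=> s; exact: sin_max].
Qed.

Lemma integrable_osc_im (x : R) :
  mu.-integrable setT (EFin \o (fun s : R => sin (x * th s) * u s + cos (x * th s) * v s)).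
Proof.
apply: (@integrableD _ _ _ mu setT measurableT
  (EFin \o (fun s : R => sin (x * th s) * u s)) (EFin \o (fun s : R => cos (x * th s) * v s))).
  by apply: integrable_bounded => //; [mfun|move=> s; exact: sin_max].
by apply: integrable_bounded => //; [mfun|move=> s; exact: cos_max].
Qed.

(** Real part of [e^{i x (th(s) - th(r))}] times [G(s)] times the conjugate of [G(r)]: the integrand
    of the squared modulus once it is written as a double integral. *)
Let K (x : R) (z : R * R) :=
  cos (x * (th z.1 - th z.2)) * (u z.1 * u z.2 + v z.1 * v z.2) +
  sin (x * (th z.1 - th z.2)) * (u z.1 * v z.2 - v z.1 * u z.2).

Let KE x : (fun z => (cos (x * th z.1) * u z.1 - sin (x * th z.1) * v z.1) *
                     (cos (x * th z.2) * u z.2 - sin (x * th z.2) * v z.2) +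
                     (sin (x * th z.1) * u z.1 + cos (x * th z.1) * v z.1) *
                     (sin (x * th z.2) * u z.2 + cos (x * th z.2) * v z.2)) = K x.
Proof.
by apply/funext => z; rewrite /K (mulrBr x) cosB sinB; ring.
Qed.

Let iK x : mu2.-integrable setT (EFin \o K x).
Proof.
rewrite -KE.
apply: (@integrableD _ _ _ mu2 setT measurableT
  (EFin \o (fun z => (cos (x * th z.1) * u z.1 - sin (x * th z.1) * v z.1) *
                     (cos (x * th z.2) * u z.2 - sin (x * th z.2) * v z.2)))
  (EFin \o (fun z => (sin (x * th z.1) * u z.1 + cos (x * th z.1) * v z.1) *
                     (sin (x * th z.2) * u z.2 + cos (x * th z.2) * v z.2)))).
  exact: (integrable_prod (integrable_osc_re x) (integrable_osc_re x)).
exact: (integrable_prod (integrable_osc_im x) (integrable_osc_im x)).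
Qed.

Let osc_sqr x : osc_re x ^+ 2 + osc_im x ^+ 2 = \int[mu2]_z K x z.
Proof.
rewrite !expr2 /osc_re /osc_im.
rewrite (Rintegral_prod (integrable_osc_re x) (integrable_osc_re x)).
rewrite (Rintegral_prod (integrable_osc_im x) (integrable_osc_im x)).
rewrite -RintegralD//; last 2 first.
  exact: (integrable_prod (integrable_osc_re x) (integrable_osc_re x)).
  exact: (integrable_prod (integrable_osc_im x) (integrable_osc_im x)).
by rewrite -KE.
Qed.

(** [K] has no decay in [x], being bounded only by (|u(s)| + |v(s)|)(|u(r)| + |v(r)|); the
    exponential weight makes the triple integral absolutely convergent, so that Fubini may bring the
    integral in [x] inside. *)
Let iwK : (mu \x @lebesgue_plane R)%E.-integrable setT
  (EFin \o (fun p : R * (R * R) => expR (- d * `|p.1|) * K p.1 p.2)).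
Proof.
have iuv : mu.-integrable setT (EFin \o (fun s => `|u s| + `|v s|)).
  by apply: (@integrableD _ _ _ mu setT measurableT (EFin \o (fun s => `|u s|))
     (EFin \o (fun s => `|v s|))); exact: integrable_norm.
have := @integrable_prod _ _ _ _ R mu (@lebesgue_plane R) _ _
  (integrable_expRN_norm d0) (integrable_prod iuv iuv).
apply: le_integrable => //.
  by apply/measurable_EFinP; rewrite /K; mfun.
move=> [x [s r]] _ /=; rewrite lee_fin !(normrM (expR _)) ler_wpM2l//.
rewrite (ger0_norm (mulr_ge0 _ _)) ?addr_ge0//.
have -> : (`|u s| + `|v s|) * (`|u r| + `|v r|) = `|u s| * `|u r| + `|v s| * `|v r|
   + (`|u s| * `|v r| + `|v s| * `|u r|) by ring.
rewrite /K/= (le_trans (ler_normD _ _))// lerD// normrM.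
  rewrite (le_trans (ler_piMl _ (cos_max _)))//.
  by rewrite (le_trans (ler_normD _ _))// !normrM.
rewrite (le_trans (ler_piMl _ (sin_max _)))//.
by rewrite (le_trans (ler_normB _ _))// !normrM.
Qed.

Let iwKx x : mu2.-integrable setT (EFin \o (fun z => expR (- d * `|x|) * K x z)).
Proof. by have /(@integrableZl _ _ _ mu2 setT measurableT (expR (- d * `|x|))) := iK x. Qed.

Let intKx z : (\int[mu]_x (expR (- d * `|x|) * K x z)%:E = (poisson_form z)%:E)%E.
Proof.
pose a := u z.1 * u z.2 + v z.1 * v z.2.
pose b := u z.1 * v z.2 - v z.1 * u z.2.
pose D := th z.1 - th z.2.
have ic := bounded_integrable_expRN_norm d0 (measurable_cosM D) (fun x => cos_max _).
have isn := bounded_integrable_expRN_norm d0 (measurable_sinM D) (fun x => sin_max _).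
transitivity (\int[mu]_x ((a * (expR (- d * `|x|) * cos (x * D)))%:E +
    (b * (expR (- d * `|x|) * sin (x * D)))%:E))%E.
  apply: eq_integral => x _; rewrite -EFinD /K -/a -/b -/D; congr (_%:E); ring.
rewrite integralD_EFin//; last 2 first.
  exact: (@integrableZl _ _ _ mu setT measurableT a _ ic).
  exact: (@integrableZl _ _ _ mu setT measurableT b _ isn).
rewrite (_ : (\int[mu]_x _ = a%:E * \int[mu]_x (expR (- d * `|x|) * cos (x * D))%:E)%E); last first.
  by rewrite -(integralZl measurableT ic); apply: eq_integral.
rewrite (_ : (\int[mu]_x (b * _)%:E = b%:E * \int[mu]_x (expR (- d * `|x|) * sin (x * D))%:E)%E); last first.
  by rewrite -(integralZl measurableT isn); apply: eq_integral.
rewrite -[(\int[mu]_x (expR (- d * `|x|) * cos (x * D))%:E)%E]fineK ?integrable_fin_num//.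
rewrite -[(\int[mu]_x (expR (- d * `|x|) * sin (x * D))%:E)%E]fineK ?integrable_fin_num//.
rewrite -/(Rintegral _ _ _) -/(Rintegral _ _ _).
by rewrite integral_expR_cos// integral_expR_sin// mule0 adde0 -EFinM.
Qed.

Lemma integrable_poisson_form : mu2.-integrable setT (EFin \o poisson_form).
Proof.
have iuv : mu.-integrable setT (EFin \o (fun s => `|u s| + `|v s|)).
  by apply: (@integrableD _ _ _ mu setT measurableT (EFin \o (fun s => `|u s|))
     (EFin \o (fun s => `|v s|))); exact: integrable_norm.
have := @integrableZl _ _ _ mu2 setT measurableT (2 / d) _ (integrable_prod iuv iuv).
apply: le_integrable => //.
  by apply/measurable_EFinP; rewrite /poisson_form; mfun.
move=> [s r] _ /=; rewrite lee_fin /poisson_form/= mulrC normrM [leRHS]normrM ler_pM//.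
  rewrite (ger0_norm (ltW (poisson_gt0 _ d0))) (le_trans (poisson_le _ d0))//.
  exact: ler_norm.
rewrite (ger0_norm (mulr_ge0 _ _)) ?addr_ge0//.
rewrite (le_trans (ler_normD _ _))// !normrM.
by rewrite mulrDl !mulrDr lerD// ?lerDl ?lerDr mulr_ge0.
Qed.

Lemma integral_osc :
  (\int[mu]_x (expR (- d * `|x|) * (osc_re x ^+ 2 + osc_im x ^+ 2))%:E =
   \int[mu2]_z (poisson_form z)%:E)%E.
Proof.
transitivity (\int[mu]_x \int[mu2]_z (expR (- d * `|x|) * K x z)%:E)%E.
  apply: eq_integral => x _; rewrite osc_sqr -RintegralZl//.
  by rewrite EFin_Rintegral//; exact: iwKx.
transitivity (\int[mu2]_z \int[mu]_x (expR (- d * `|x|) * K x z)%:E)%E.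
  exact: (@Fubini _ _ _ _ _ mu (@lebesgue_plane R) _ iwK).
by apply: eq_integral => z _; exact: intKx.
Qed.

End oscillatory.

(** * The Schur bound and the two Plancherel inequalities *)

Section plancherel.
Context {R : realType}.
Local Notation mu := (@lebesgue_measure R).
Local Notation mu2 := (mu \x mu)%E.

(** Monotone convergence along [d = 1/(n+1)]: the weights increase to 1, so a bound uniform in [d]
    survives their removal. *)
Lemma le_integral_expR_lim (G : R -> R) (B : \bar R) :
  measurable_fun setT G -> (forall x, 0 <= G x) ->
  (forall d : R, (0 < d)%R -> \int[mu]_x (expR (- d * `|x|) * G x)%:E <= B)%E ->
  (\int[mu]_x (G x)%:E <= B)%E.
Proof.
move=> mG G0 GB.
pose g n (x : R) := (expR (- n.+1%:R^-1 * `|x|) * G x)%:E.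
have gcvg x : g n x @[n --> \oo] --> (G x)%:E.
  apply: cvg_EFin; first exact: nearW.
  rewrite -[X in _ --> X]mul1r; apply: cvgMl; rewrite -[X in _ --> X]expR0.
  have h : - n.+1%:R^-1 * `|x| @[n --> \oo] --> (0 : R).
    rewrite -[X in _ --> X](mul0r `|x|); apply: cvgMl.
    by rewrite -oppr0; apply: cvgN; exact: cvg_harmonic.
  by apply: (continuous_cvg _ _ h); exact: continuous_expR.
have mg n : measurable_fun setT (g n) by apply/measurable_EFinP; mfun.
have g0 n x : setT x -> (0 <= g n x)%E by rewrite lee_fin mulr_ge0// expR_ge0.
have ndg x : setT x -> nondecreasing_seq (g^~ x).
  move=> _ m n mn; rewrite lee_fin ler_wpM2r// ler_expR ler_wpM2r// lerN2.
  by rewrite lef_pV2 ?posrE// ler_nat.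
have H := @cvg_monotone_convergence _ _ _ mu setT measurableT g mg g0 ndg.
have GE : (fun x => limn (g^~ x)) = (fun x => (G x)%:E).
  by apply/funext => x; apply/cvg_lim => //; exact: gcvg.
rewrite -GE -(cvg_lim (@ereal_hausdorff R) H).
apply: lime_le; first by apply/cvg_ex; eexists; exact: H.
by apply: nearW => n; apply: GB; rewrite invr_gt0.
Qed.

Section upper.
Variables (th u v : R -> R) (d : R).
Hypotheses (mth : measurable_fun setT th) (d0 : 0 < d)
  (iu : mu.-integrable setT (EFin \o u)) (iv : mu.-integrable setT (EFin \o v)).

Let mu' : measurable_fun setT u.
Proof. by have /measurable_int/measurable_EFinP := iu. Qed.
Let mv : measurable_fun setT v.
Proof. by have /measurable_int/measurable_EFinP := iv. Qed.

Lemma measurable_osc_re : measurable_fun setT (osc_re th u v).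
Proof.
apply: (measurable_Rintegral mu (f := fun p : R * R =>
  cos (p.1 * th p.2) * u p.2 - sin (p.1 * th p.2) * v p.2)).
by mfun.
Qed.

Lemma measurable_osc_im : measurable_fun setT (osc_im th u v).
Proof.
apply: (measurable_Rintegral mu (f := fun p : R * R =>
  sin (p.1 * th p.2) * u p.2 + cos (p.1 * th p.2) * v p.2)).
by mfun.
Qed.

(** Schur's test for a symmetric positive kernel: |G(s)||G(r)| <= (|G(s)|^2 + |G(r)|^2)/2, and the
    two halves have the same integral because [poisson] is even. The right-hand side is allowed to
    be infinite. *)
Lemma integral_osc_le :
  (\int[mu]_x (expR (- d * `|x|) * (osc_re th u v x ^+ 2 + osc_im th u v x ^+ 2))%:E <=
   \int[mu]_s ((u s ^+ 2 + v s ^+ 2)%:E * \int[mu]_r (poisson d (th s - th r))%:E))%E.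
Proof.
rewrite integral_osc//.
pose n s : R := u s ^+ 2 + v s ^+ 2.
have n0 s : 0 <= n s by rewrite addr_ge0// sqr_ge0.
have mn : measurable_fun setT n by rewrite /n; mfun.
pose f (z : R * R) := (2^-1 * (n z.1 * poisson d (th z.1 - th z.2)))%:E.
pose g (z : R * R) := (2^-1 * (n z.2 * poisson d (th z.1 - th z.2)))%:E.
have p0 x : 0 <= poisson d x by rewrite ltW// poisson_gt0.
have f0 z : (0 <= f z)%E by rewrite /f lee_fin mulr_ge0 ?invr_ge0// mulr_ge0.
have g0 z : (0 <= g z)%E by rewrite /g lee_fin mulr_ge0 ?invr_ge0// mulr_ge0.
have mf : measurable_fun setT f by apply/measurable_EFinP; mfun.
have mg : measurable_fun setT g by apply/measurable_EFinP; mfun.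
have mk : measurable_fun setT (poisson_form th u v d) by rewrite /poisson_form; mfun.
apply: (@le_trans _ _ (\int[mu2]_z (f z + g z))%E).
  apply: (@le_trans _ _ (\int[mu2]_z `|(poisson_form th u v d z)%:E|)%E).
    apply: (le_trans (lee_abs _)); apply: le_abse_integral => //.
    exact/measurable_EFinP.
  apply: ge0_le_integral => //.
  - by apply/measurable_EFinP; mfun.
  - exact: emeasurable_funD.
  move=> [s r] _; rewrite /f /g -EFinD lee_fin /poisson_form/= -mulrDr -mulrDl.
  rewrite normrM (ger0_norm (p0 _)) mulrA ler_wpM2r//.
  have := sqr_ge0 (u s - u r); have := sqr_ge0 (u s + u r).
  have := sqr_ge0 (v s - v r); have := sqr_ge0 (v s + v r).
  by rewrite ler_norml /n => *; apply/andP; split; lra.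
rewrite ge0_integralD//.
have inner s : (\int[mu]_r (2^-1 * (n s * poisson d (th s - th r)))%:E =
    (2^-1)%:E * ((n s)%:E * \int[mu]_r (poisson d (th s - th r))%:E))%E.
  rewrite muleA -EFinM -ge0_integralZl//; last 3 first.
  - by apply/measurable_EFinP; mfun.
  - by move=> r _; rewrite lee_fin.
  - by rewrite lee_fin mulr_ge0.
  by apply: eq_integral => r _; rewrite -EFinM mulrA.
have mI : measurable_fun setT (fun s => (n s)%:E * \int[mu]_r (poisson d (th s - th r))%:E)%E.
  apply: emeasurable_funM; first exact/measurable_EFinP.
  apply: (measurable_fun_fubini_tonelli_F (m2 := mu)
    (fun z : R * R => (poisson d (th z.1 - th z.2))%:E)).
    by apply/measurable_EFinP; mfun.
  by move=> z; rewrite lee_fin.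
have I0 s : (0 <= (n s)%:E * \int[mu]_r (poisson d (th s - th r))%:E)%E.
  by rewrite mule_ge0 ?lee_fin// integral_ge0// => r _; rewrite lee_fin.
rewrite (fubini_tonelli1 (m1 := mu) (m2 := mu) f)// (fubini_tonelli2 (m1 := mu) (m2 := mu) g)// /fubini_F /fubini_G /f /g /=.
under eq_integral do rewrite inner.
rewrite (_ : (\int[mu]_y \int[mu]_x _ = \int[mu]_s ((2^-1)%:E *
    ((n s)%:E * \int[mu]_r (poisson d (th s - th r))%:E)))%E); last first.
  apply: eq_integral => s _; rewrite -inner; apply: eq_integral => r _.
  by rewrite -(poissonN d (th s - th r)) opprB.
rewrite ge0_integralZl// -ge0_muleDl ?lee_fin//.
by rewrite -EFinD (_ : 2^-1 + 2^-1 = 1 :> R) ?mul1e//; lra.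
Qed.

End upper.

Lemma integral_poissonB (d s : R) : 0 < d ->
  (\int[mu]_r (poisson d (s - r))%:E = (2 * pi)%:E)%E.
Proof.
move=> d0; rewrite -(integral_poisson d0).
rewrite -(@ge0_integral_shift _ (- s) (fun r => (poisson d r)%:E)).
- by apply: eq_integral => r _; rewrite -poissonN opprB addrC.
- by apply/measurable_EFinP; mfun.
- by move=> r; rewrite lee_fin ltW// poisson_gt0.
Qed.

(** For the phase [id] every row integral of the kernel is 2 pi, whatever [d], so the Schur bound
    passes to the limit. *)
Lemma plancherel_le (u v : R -> R) :
  mu.-integrable setT (EFin \o u) -> mu.-integrable setT (EFin \o v) ->
  (\int[mu]_x (osc_re id u v x ^+ 2 + osc_im id u v x ^+ 2)%:E <=
   (2 * pi)%:E * \int[mu]_s (u s ^+ 2 + v s ^+ 2)%:E)%E.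
Proof.
move=> iu iv.
have mu' : measurable_fun setT u by have /measurable_int/measurable_EFinP := iu.
have mv : measurable_fun setT v by have /measurable_int/measurable_EFinP := iv.
have mre := measurable_osc_re (@measurable_id _ _ setT) iu iv.
have mim := measurable_osc_im (@measurable_id _ _ setT) iu iv.
apply: le_integral_expR_lim; first by mfun.
  by move=> x; rewrite addr_ge0// sqr_ge0.
move=> d d0.
apply: (le_trans (integral_osc_le (@measurable_id _ _ setT) d0 iu iv)).
under eq_integral do rewrite integral_poissonB//.
rewrite ge0_integralZr//; first by rewrite muleC.
- by apply/measurable_EFinP; mfun.
- by move=> s _; rewrite lee_fin addr_ge0// sqr_ge0.
- by rewrite lee_fin mulr_ge0// pi_ge0.
Qed.

Lemma integral_poisson_fst (n : R -> R) (d : R) : 0 < d ->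
  measurable_fun setT n -> (forall x, 0 <= n x) ->
  (\int[mu2]_z (n z.1 * poisson d (z.1 - z.2))%:E = (2 * pi)%:E * \int[mu]_s (n s)%:E)%E.
Proof.
move=> d0 mn n0.
have p0 x : 0 <= poisson d x by rewrite ltW// poisson_gt0.
rewrite (fubini_tonelli1 (m1 := mu) (m2 := mu)
  (fun z : R * R => (n z.1 * poisson d (z.1 - z.2))%:E))//; last 2 first.
  by apply/measurable_EFinP; mfun.
  by move=> z; rewrite lee_fin mulr_ge0.
rewrite -ge0_integralZl ?lee_fin//; last 3 first.
- exact/measurable_EFinP.
- by move=> s _; rewrite lee_fin.
- by rewrite mulr_ge0// pi_ge0.
apply: eq_integral => s _; rewrite /fubini_F /= muleC -(@integral_poissonB d s)//.
rewrite -ge0_integralZl ?lee_fin//.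
- by apply/measurable_EFinP; mfun.
- by move=> r _; rewrite lee_fin.
Qed.

Lemma integral_poisson_snd (n : R -> R) (d : R) : 0 < d ->
  measurable_fun setT n -> (forall x, 0 <= n x) ->
  (\int[mu2]_z (n z.2 * poisson d (z.1 - z.2))%:E = (2 * pi)%:E * \int[mu]_s (n s)%:E)%E.
Proof.
move=> d0 mn n0; rewrite -(integral_poisson_fst d0 mn n0).
have p0 x : 0 <= poisson d x by rewrite ltW// poisson_gt0.
pose f (z : R * R) := (n z.1 * poisson d (z.1 - z.2))%:E.
pose g (z : R * R) := (n z.2 * poisson d (z.1 - z.2))%:E.
have mf : measurable_fun setT f by apply/measurable_EFinP; mfun.
have mg : measurable_fun setT g by apply/measurable_EFinP; mfun.
have f0 z : (0 <= f z)%E by rewrite /f lee_fin mulr_ge0.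
have g0 z : (0 <= g z)%E by rewrite /g lee_fin mulr_ge0.
rewrite [LHS](fubini_tonelli2 (m1 := mu) (m2 := mu) g mg g0).
rewrite [RHS](fubini_tonelli1 (m1 := mu) (m2 := mu) f mf f0).
rewrite /fubini_F /fubini_G /f /g.
apply: eq_integral => s _; apply: eq_integral => r _ /=.
by rewrite -(poissonN d (s - r)) opprB.
Qed.

(** Polarisation: with [n = u^2 + v^2], the quadratic form is half of n(s) + n(r), which contributes
    exactly 2 pi times the integral of [n], minus half of the squared increment. The last hypothesis
    makes this loss O(d): the factor (s - r)^2 cancels the singularity of the kernel on the diagonal
    as [d] tends to 0, and 1/(1 + (s - r)^2) keeps the integral over the plane finite. *)
Lemma plancherel_ge (u v c : R -> R) (M : R) :
  mu.-integrable setT (EFin \o u) -> mu.-integrable setT (EFin \o v) ->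
  mu.-integrable setT (EFin \o (fun s => u s ^+ 2 + v s ^+ 2)) ->
  mu.-integrable setT (EFin \o c) -> (forall s, 0 <= c s) -> 0 <= M ->
  (forall s r, (u s - u r) ^+ 2 + (v s - v r) ^+ 2 <=
    M * (c s + c r) * ((s - r) ^+ 2 / (1 + (s - r) ^+ 2))) ->
  ((2 * pi)%:E * \int[mu]_s (u s ^+ 2 + v s ^+ 2)%:E <=
   \int[mu]_x (osc_re id u v x ^+ 2 + osc_im id u v x ^+ 2)%:E)%E.
Proof.
move=> iu iv inn ic c0 M0 uvM.
pose n s : R := u s ^+ 2 + v s ^+ 2.
have n0 s : 0 <= n s by rewrite addr_ge0// sqr_ge0.
have mu' : measurable_fun setT u by have /measurable_int/measurable_EFinP := iu.
have mv : measurable_fun setT v by have /measurable_int/measurable_EFinP := iv.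
have mc : measurable_fun setT c by have /measurable_int/measurable_EFinP := ic.
have mn : measurable_fun setT n by rewrite /n; mfun.
have mre := measurable_osc_re (@measurable_id _ _ setT) iu iv.
have mim := measurable_osc_im (@measurable_id _ _ setT) iu iv.
(* The majorant [D] of the loss, introduced below, has integral [d * C]; being linear in [d], it is
   made smaller than any [e]. *)
pose C : R := M * (2 * pi * fine (\int[mu]_s (c s)%:E)%E).
suff H (d : R) : 0 < d -> ((2 * pi)%:E * \int[mu]_s (n s)%:E <=
   \int[mu]_x (osc_re id u v x ^+ 2 + osc_im id u v x ^+ 2)%:E + (d * C)%:E)%E.
  apply/lee_addgt0Pr => e e0.
  have C1 : 0 < `|C| + 1 by rewrite ltr_wpDl.
  apply: (le_trans (H (e / (`|C| + 1)) _)); first by rewrite divr_gt0.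
  rewrite leeD2l// lee_fin mulrAC ler_pdivrMr// ler_pM2l//.
  by rewrite (le_trans (ler_norm _))// lerDl.
move=> d0.
have p0 x : 0 <= poisson d x by rewrite ltW// poisson_gt0.
pose m (z : R * R) := (u z.1 - u z.2) ^+ 2 + (v z.1 - v z.2) ^+ 2.
have m0 z : 0 <= m z by rewrite addr_ge0// sqr_ge0.
have mm : measurable_fun setT m by rewrite /m; mfun.
pose Bz (z : R * R) := 2^-1 * m z * poisson d (z.1 - z.2).
have B0 z : 0 <= Bz z by rewrite /Bz mulr_ge0// mulr_ge0// invr_ge0.
have mB : measurable_fun setT Bz by rewrite /Bz; mfun.
pose D (z : R * R) := d * M * (2^-1 * (c z.1 * poisson 1 (z.1 - z.2) + c z.2 * poisson 1 (z.1 - z.2))).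
have BD z : Bz z <= D z.
  case: z => s r; rewrite /Bz /D /m /=.
  have -> : d * M * (2^-1 * (c s * poisson 1 (s - r) + c r * poisson 1 (s - r))) =
    2^-1 * (M * (c s + c r) * (d * poisson 1 (s - r))) by ring.
  rewrite -mulrA ler_wpM2l ?invr_ge0//.
  have := uvM s r; move: (s - r) => t mt.
  have t1 : 0 < 1 + t ^+ 2 by rewrite ltr_pwDl// sqr_ge0.
  have td := poisson_den_gt0 t d0.
  apply: (le_trans (ler_wpM2r (p0 _) mt)).
  rewrite -(mulrA (M * _)) ler_wpM2l// ?mulr_ge0 ?addr_ge0//.
  rewrite /poisson expr1n mulr1.
  (* A factor [d] and the Poisson kernel at 1 come out; the last quotient is at most 1. *)
  have -> : t ^+ 2 / (1 + t ^+ 2) * (2 * d / (d ^+ 2 + t ^+ 2)) =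
     d * (2 / (1 + t ^+ 2)) * (t ^+ 2 / (d ^+ 2 + t ^+ 2)).
    by field; rewrite !gt_eqF.
  rewrite ler_piMr ?mulr_ge0 ?invr_ge0 ?(ltW d0) ?(ltW t1)//.
  by rewrite ler_pdivrMr// mul1r lerDr sqr_ge0.
have iD : (\int[mu2]_z (D z)%:E = (d * C)%:E)%E.
  have q0 x : 0 <= poisson 1 x :> R by rewrite ltW// poisson_gt0.
  pose f (z : R * R) := (c z.1 * poisson 1 (z.1 - z.2))%:E.
  pose g (z : R * R) := (c z.2 * poisson 1 (z.1 - z.2))%:E.
  have mf : measurable_fun setT f by apply/measurable_EFinP; mfun.
  have mg : measurable_fun setT g by apply/measurable_EFinP; mfun.
  have f0 z : (0 <= f z)%E by rewrite /f lee_fin mulr_ge0.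
  have g0 z : (0 <= g z)%E by rewrite /g lee_fin mulr_ge0.
  transitivity (\int[mu2]_z ((d * M * 2^-1)%:E * (f z + g z)))%E.
    by apply: eq_integral => z _; rewrite /f /g /= -EFinD -EFinM /D mulrA.
  rewrite ge0_integralZl//; last 3 first.
  - exact: emeasurable_funD.
  - by move=> z _; exact: adde_ge0.
  - by rewrite lee_fin !mulr_ge0 ?invr_ge0// ltW.
  rewrite ge0_integralD// integral_poisson_fst// integral_poisson_snd//.
  rewrite -(EFin_Rintegral ic) -EFinM; congr (_%:E).
  by rewrite /C -/(Rintegral _ _ _); field.
have iB : mu2.-integrable setT (EFin \o Bz).
  apply/integrableP; split; first exact/measurable_EFinP.
  apply: (@le_lt_trans _ _ (d * C)%:E); last exact: ltry.
  rewrite -iD; apply: ge0_le_integral => //.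
  - by apply/measurable_EFinP; mfun.
  - by apply/measurable_EFinP; rewrite /D; mfun.
  - by move=> z _; rewrite /= lee_fin ger0_norm.
have mid := @measurable_id _ _ [set: R].
have iP := integrable_poisson_form mid d0 iu iv.
have -> : ((2 * pi)%:E * \int[mu]_s (n s)%:E =
  \int[mu2]_z ((poisson_form id u v d z)%:E + (Bz z)%:E))%E.
  pose f (z : R * R) := (n z.1 * poisson d (z.1 - z.2))%:E.
  pose g (z : R * R) := (n z.2 * poisson d (z.1 - z.2))%:E.
  have mf : measurable_fun setT f by apply/measurable_EFinP; mfun.
  have mg : measurable_fun setT g by apply/measurable_EFinP; mfun.
  have f0 z : (0 <= f z)%E by rewrite /f lee_fin mulr_ge0.
  have g0 z : (0 <= g z)%E by rewrite /g lee_fin mulr_ge0.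
  transitivity (\int[mu2]_z ((2^-1)%:E * (f z + g z)))%E; last first.
    apply: eq_integral => -[s r] _; rewrite /f /g /= -!EFinD -EFinM.
    by rewrite /poisson_form /Bz /m /n /=; congr (_%:E); field.
  rewrite ge0_integralZl//; last 2 first.
  - exact: emeasurable_funD.
  - by move=> z _; exact: adde_ge0.
  rewrite ge0_integralD// integral_poisson_fst// integral_poisson_snd//.
  rewrite -(EFin_Rintegral inn) -/(n _) -EFinM; congr (_%:E).
  by field.
rewrite integralD_EFin//; apply: leeD; last first.
  rewrite -iD; apply: ge0_le_integral => //.
  - by move=> z _; rewrite lee_fin.
  - exact/measurable_EFinP.
  - by apply/measurable_EFinP; rewrite /D; mfun.
  - by move=> z _; rewrite lee_fin.
rewrite -(integral_osc mid d0 iu iv); apply: ge0_le_integral => //.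
- by move=> x _; rewrite lee_fin mulr_ge0 ?expR_ge0// addr_ge0// sqr_ge0.
- by apply/measurable_EFinP; mfun.
- by apply/measurable_EFinP; mfun.
- move=> x _; rewrite lee_fin ler_piMl ?addr_ge0 ?sqr_ge0//.
  by rewrite -expR0 ler_expR mulNr oppr_le0 mulr_ge0// ltW.
Qed.

End plancherel.

(** * The bilinear estimate *)

Section convolution.
Context {R : realType}.
Local Notation mu := (@lebesgue_measure R).
Local Notation mu2 := (mu \x mu)%E.

Lemma Rintegral_shift (q : R -> R) (c : R) : measurable_fun setT q ->
  \int[mu]_x q (c + x) = \int[mu]_x q x.
Proof.
move=> mq.
have mE : measurable_fun setT (EFin \o q) by exact/measurable_EFinP.
congr fine; rewrite integralE [RHS]integralE; congr (_ - _)%E.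
  rewrite -[RHS](@ge0_integral_shift _ c (EFin \o q)^\+%E)//; last exact: measurable_funepos.
  by apply: eq_integral => x _; rewrite !unlock.
rewrite -[RHS](@ge0_integral_shift _ c (EFin \o q)^\-%E)//; last exact: measurable_funeneg.
by apply: eq_integral => x _; rewrite !unlock.
Qed.

Lemma integrable_shift (q : R -> R) (c : R) : mu.-integrable setT (EFin \o q) ->
  mu.-integrable setT (EFin \o (fun x => q (c + x))).
Proof.
move=> iq.
have mq : measurable_fun setT q by have /measurable_int/measurable_EFinP := iq.
have [_ iq1] := integrableP _ _ _ iq.
apply/integrableP; split; first by apply/measurable_EFinP; mfun.
rewrite (@ge0_integral_shift _ c (fun s => `|q s|%:E))//.
by apply/measurable_EFinP; mfun.
Qed.

Lemma integrable_conv (p q : R -> R) :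
  mu.-integrable setT (EFin \o p) -> mu.-integrable setT (EFin \o q) ->
  mu2.-integrable setT (EFin \o (fun z => p z.2 * q (z.1 - z.2))).
Proof.
move=> ip iq.
have mp : measurable_fun setT p by have /measurable_int/measurable_EFinP := ip.
have mq : measurable_fun setT q by have /measurable_int/measurable_EFinP := iq.
apply/integrable21ltyP; first by apply/measurable_EFinP; mfun.
have E y : (\int[mu]_x `|p y * q (x - y)|%:E = `|p y|%:E * \int[mu]_x `|q x|%:E)%E.
  rewrite -(@ge0_integral_shift _ (- y) (fun x => `|q x|%:E))//; last first.
    by apply/measurable_EFinP; mfun.
  rewrite -ge0_integralZl//; last first.
    by apply/measurable_EFinP; mfun.
  by apply: eq_integral => x _; rewrite normrM EFinM (addrC x).
under eq_integral do rewrite /= E.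
have [_ ip1] := integrableP _ _ _ ip.
have [_ iq1] := integrableP _ _ _ iq.
rewrite ge0_integralZr//; last 2 first.
  by apply/measurable_EFinP; mfun.
  exact: integral_ge0.
by rewrite lte_mul_pinfty// ?integral_ge0// ge0_fin_numE ?integral_ge0.
Qed.

(** The sup bound on [q] yields integrability at every [s], where integrability of [p] and [q] alone
    would yield it for almost every [s]. *)
Lemma integrable_conv_pt (p q : R -> R) (M s : R) :
  mu.-integrable setT (EFin \o p) -> measurable_fun setT q -> (forall x, `|q x| <= M) ->
  mu.-integrable setT (EFin \o (fun x => p x * q (s - x))).
Proof.
move=> ip mq qM.
have mp : measurable_fun setT p by have /measurable_int/measurable_EFinP := ip.
have := @integrableZl _ _ _ mu setT measurableT M _ (integrable_norm ip).
apply: le_integrable => //; first by apply/measurable_EFinP; mfun.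
move=> x _ /=; rewrite lee_fin !normrM normr_id mulrC ler_wpM2r//.
by rewrite (le_trans (qM _))// ler_norm.
Qed.

Lemma integrable_conv_fst (p q : R -> R) (M : R) :
  mu.-integrable setT (EFin \o p) -> mu.-integrable setT (EFin \o q) ->
  (forall x, `|q x| <= M) ->
  mu.-integrable setT (EFin \o (fun s => \int[mu]_x (p x * q (s - x)))).
Proof.
move=> ip iq qM.
have mq : measurable_fun setT q by have /measurable_int/measurable_EFinP := iq.
have := @integrable_fubini_F _ _ _ _ _ mu mu _ (integrable_conv ip iq).
apply: eq_integrable => // s _.
by rewrite /fubini_F /= EFin_Rintegral//; exact: integrable_conv_pt qM.
Qed.

Lemma Rintegral_conv (p q : R -> R) (M : R) :
  mu.-integrable setT (EFin \o p) -> mu.-integrable setT (EFin \o q) ->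
  (forall x, `|q x| <= M) ->
  (\int[mu]_x p x) * (\int[mu]_x q x) = \int[mu]_s \int[mu]_x (p x * q (s - x)).
Proof.
move=> ip iq qM.
have mp : measurable_fun setT p by have /measurable_int/measurable_EFinP := ip.
have mq : measurable_fun setT q by have /measurable_int/measurable_EFinP := iq.
apply: EFin_inj; rewrite (EFin_Rintegral (integrable_conv_fst ip iq qM)).
transitivity (\int[mu]_s \int[mu]_x (p x * q (s - x))%:E)%E; last first.
  apply: eq_integral => s _.
  by rewrite EFin_Rintegral//; exact: integrable_conv_pt qM.
rewrite (@Fubini _ _ _ _ _ mu mu _ (integrable_conv ip iq))/=.
transitivity (\int[mu]_x (p x * \int[mu]_s q s)%:E)%E; last first.
  apply: eq_integral => x _; rewrite EFinM.
  rewrite -(Rintegral_shift (- x) mq) EFin_Rintegral; last exact: integrable_shift.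
  rewrite -(integralZl measurableT (integrable_shift (- x) iq)).
  by apply: eq_integral => s _; rewrite (addrC s).
rewrite -EFin_Rintegral ?RintegralZr//.
have := @integrableZl _ _ _ mu setT measurableT (\int[mu]_s q s) _ ip.
by apply: eq_integrable => // x _; rewrite /= mulrC.
Qed.

End convolution.

(** * The Poisson kernel along a quadratic phase *)

Section kernel_bound.
Context {R : realType}.
Local Notation mu := (@lebesgue_measure R).

(** For the phase x^2 + (s - x)^2 the difference of two values factors as 2a(a + w), with zeros a =
    0 and a = -w. Near each zero the other factor has size about |w|, so for large w the kernel
    looks like a Poisson kernel of width 1/<w>; the prefactor 2/<w> brings the height of each
    majorant down to 4. *)
Lemma poisson_quartic_le (a w : R) :
  poisson 1 (2 * a * (a + w)) <=
  2 / Num.sqrt (1 + w ^+ 2) *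
    (poisson (Num.sqrt (1 + w ^+ 2))^-1 a + poisson (Num.sqrt (1 + w ^+ 2))^-1 (a + w)).
Proof.
set m := Num.sqrt (1 + w ^+ 2).
have w1 : 0 < 1 + w ^+ 2 by rewrite ltr_pwDl// sqr_ge0.
have m0 : 0 < m by rewrite sqrtr_gt0.
have m2 : m ^+ 2 = 1 + w ^+ 2 by rewrite sqr_sqrtr// ltW.
have pE x : 2 / m * poisson m^-1 x = 4 / (1 + m ^+ 2 * x ^+ 2).
  rewrite /poisson; field.
  by rewrite (gt_eqF m0) gt_eqF// ltr_pwDl// sqr_ge0.
rewrite (mulrDr (2 / m)) !pE m2 /poisson expr1n mulr1.
have d0 x : 0 < 1 + (1 + w ^+ 2) * x ^+ 2.
  by rewrite ltr_pwDl// mulr_ge0 ?sqr_ge0// ltW.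
have D0 : 0 < 1 + (2 * a * (a + w)) ^+ 2 by rewrite ltr_pwDl// sqr_ge0.
(* At least one of [a], [a + w] has absolute value at most the other one, hence
   the other one is at least [|w| / 2]. *)
have key x y : w = y - x \/ w = x - y -> x ^+ 2 <= y ^+ 2 ->
    2 / (1 + (2 * x * y) ^+ 2) <= 4 / (1 + (1 + w ^+ 2) * x ^+ 2).
  move=> wE xy.
  have E0 : 0 < 1 + (2 * x * y) ^+ 2 by rewrite ltr_pwDl// sqr_ge0.
  rewrite ler_pdivrMr// mulrAC ler_pdivlMr//.
  have wy : w ^+ 2 <= 4 * y ^+ 2.
    have : w ^+ 2 <= 2 * x ^+ 2 + 2 * y ^+ 2.
      have := sqr_ge0 (x + y); have : w ^+ 2 = (x - y) ^+ 2 by case: wE => ->; ring.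
      by move=> ->; lra.
    lra.
  have x0 := sqr_ge0 x.
  have h1 : w ^+ 2 * x ^+ 2 <= 4 * y ^+ 2 * x ^+ 2 by rewrite ler_wpM2r.
  have h2 : x ^+ 2 * x ^+ 2 <= y ^+ 2 * x ^+ 2 by rewrite ler_wpM2r.
  (* Supplies x^2 <= x^4 + 1/4, and [h2] turns x^4 into x^2 y^2: this absorbs the one term in x^2
     that comes without the weight w^2. *)
  have h3 := sqr_ge0 (x ^+ 2 - 2^-1).
  lra.
have [h|h] := leP (a ^+ 2) ((a + w) ^+ 2).
  apply: (le_trans (key a (a + w) _ h)); first by left; ring.
  by rewrite lerDl divr_ge0// ltW.
have -> : 2 * a * (a + w) = 2 * (a + w) * a by ring.
apply: (le_trans (key (a + w) a _ (ltW h))); first by right; ring.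
by rewrite lerDr divr_ge0// ltW.
Qed.

(** Each of the two Poisson kernels has mass 2 pi, and 2/<w> times 4 pi is 8 pi/<w>. Here w = xi -
    (s - xi) is the gap between the two interacting frequencies, so averaging in time gains a full
    inverse power of the gap. *)
Lemma integral_phase_le (s xi : R) :
  (\int[mu]_r (poisson 1 (xi ^+ 2 + (s - xi) ^+ 2 - (r ^+ 2 + (s - r) ^+ 2)))%:E <=
   (8 * pi / Num.sqrt (1 + (2 * xi - s) ^+ 2))%:E)%E.
Proof.
set w := 2 * xi - s; set m := Num.sqrt (1 + w ^+ 2).
have w1 : 0 < 1 + w ^+ 2 by rewrite ltr_pwDl// sqr_ge0.
have m0 : 0 < m by rewrite sqrtr_gt0.
have mi0 : 0 < m^-1 by rewrite invr_gt0.
have p0 x : 0 <= poisson m^-1 x by rewrite ltW// poisson_gt0.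
have q0 x : 0 <= poisson 1 x :> R by rewrite ltW// poisson_gt0.
pose f r := (poisson m^-1 (xi - r))%:E.
pose g r := (poisson m^-1 (s - xi - r))%:E.
have mf : measurable_fun setT f by apply/measurable_EFinP; mfun.
have mg : measurable_fun setT g by apply/measurable_EFinP; mfun.
apply: (@le_trans _ _ (\int[mu]_r ((2 / m)%:E * (f r + g r)))%E).
  apply: ge0_le_integral => //.
  - by move=> r _; rewrite lee_fin.
  - by apply/measurable_EFinP; mfun.
  - apply: measurable_funeM; exact: emeasurable_funD.
  move=> r _; rewrite /f /g -EFinD -EFinM lee_fin.
  have := poisson_quartic_le (r - xi) w.
  rewrite -/m -(poissonN m^-1 (r - xi)) opprB.
  have -> : r - xi + w = - (s - xi - r) by rewrite /w; ring.
  rewrite poissonN; apply: le_trans.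
  by rewrite -poissonN le_eqVlt; apply/orP; left; apply/eqP; congr poisson; ring.
rewrite ge0_integralZl//; last 3 first.
- exact: emeasurable_funD.
- by move=> r _; rewrite adde_ge0// lee_fin.
- by rewrite lee_fin divr_ge0// ltW.
rewrite ge0_integralD//; last 2 first.
- by move=> r _; rewrite lee_fin.
- by move=> r _; rewrite lee_fin.
rewrite /f /g !integral_poissonB// -EFinD -EFinM lee_fin le_eqVlt.
by apply/orP; left; apply/eqP; field; rewrite gt_eqF.
Qed.

End kernel_bound.

(** * The square of a transform as the transform of a self-convolution *)

Section bilinear.
Context {R : realType}.
Local Notation mu := (@lebesgue_measure R).

(** [conv_re + i conv_im] is the convolution of [a + i b] with itself. There is no conjugate: what
    becomes a transform again is the square, whose modulus carries all that an even power needs. *)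
Definition conv_re (a b : R -> R) (s : R) :=
  \int[mu]_y (a y * a (s - y) - b y * b (s - y)).
Definition conv_im (a b : R -> R) (s : R) :=
  \int[mu]_y (a y * b (s - y) + b y * a (s - y)).

Section square.
Variables (a b : R -> R) (M : R).
Hypotheses (ia : mu.-integrable setT (EFin \o a)) (ib : mu.-integrable setT (EFin \o b))
  (aM : forall x, `|a x| <= M) (bM : forall x, `|b x| <= M).

Let ma : measurable_fun setT a.
Proof. by have /measurable_int/measurable_EFinP := ia. Qed.
Let mb : measurable_fun setT b.
Proof. by have /measurable_int/measurable_EFinP := ib. Qed.

Lemma integrable_conv_re_pt s :
  mu.-integrable setT (EFin \o (fun y => a y * a (s - y) - b y * b (s - y))).
Proof.
apply: (@integrableB _ _ _ mu setT measurableT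
  (EFin \o (fun y => a y * a (s - y))) (EFin \o (fun y => b y * b (s - y))));
  exact: integrable_conv_pt.
Qed.

Lemma integrable_conv_im_pt s :
  mu.-integrable setT (EFin \o (fun y => a y * b (s - y) + b y * a (s - y))).
Proof.
apply: (@integrableD _ _ _ mu setT measurableT
  (EFin \o (fun y => a y * b (s - y))) (EFin \o (fun y => b y * a (s - y))));
  exact: integrable_conv_pt.
Qed.

Lemma conv_reE s : conv_re a b s =
  \int[mu]_y (a y * a (s - y)) - \int[mu]_y (b y * b (s - y)).
Proof. by rewrite /conv_re RintegralB//; exact: integrable_conv_pt. Qed.

Lemma conv_imE s : conv_im a b s =
  \int[mu]_y (a y * b (s - y)) + \int[mu]_y (b y * a (s - y)).
Proof. by rewrite /conv_im RintegralD//; exact: integrable_conv_pt. Qed.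

Lemma integrable_conv_re : mu.-integrable setT (EFin \o conv_re a b).
Proof.
rewrite (_ : EFin \o _ = EFin \o (fun s => \int[mu]_y (a y * a (s - y)))%R \-
  (EFin \o (fun s => \int[mu]_y (b y * b (s - y)))%R))%E; last first.
  by apply/funext => s; rewrite /= conv_reE.
by apply: integrableB => //; [exact: (integrable_conv_fst ia ia aM)|exact: (integrable_conv_fst ib ib bM)].
Qed.

Lemma integrable_conv_im : mu.-integrable setT (EFin \o conv_im a b).
Proof.
rewrite (_ : EFin \o _ = EFin \o (fun s => \int[mu]_y (a y * b (s - y)))%R \+
  (EFin \o (fun s => \int[mu]_y (b y * a (s - y)))%R))%E; last first.
  by apply/funext => s; rewrite /= conv_imE.
by apply: integrableD => //; [exact: (integrable_conv_fst ia ib bM)|exact: (integrable_conv_fst ib ia aM)].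
Qed.

Lemma Rintegral_sqrB :
  (\int[mu]_x a x) ^+ 2 - (\int[mu]_x b x) ^+ 2 = \int[mu]_s conv_re a b s.
Proof.
rewrite !expr2 (Rintegral_conv ia ia aM) (Rintegral_conv ib ib bM) -RintegralB//.
- by apply: eq_Rintegral => s _; rewrite conv_reE.
- exact: (integrable_conv_fst ia ia aM).
- exact: (integrable_conv_fst ib ib bM).
Qed.

Lemma Rintegral_mul2 :
  2 * (\int[mu]_x a x) * (\int[mu]_x b x) = \int[mu]_s conv_im a b s.
Proof.
rewrite mulr2n -mulrA mulrDl mul1r [X in _ + X]mulrC.
rewrite (Rintegral_conv ia ib bM) (Rintegral_conv ib ia aM) -RintegralD//.
- by apply: eq_Rintegral => s _; rewrite conv_imE.
- exact: (integrable_conv_fst ia ib bM).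
- exact: (integrable_conv_fst ib ia aM).
Qed.

End square.

Section modulated.
Variables (a b : R -> R) (M : R).
Hypotheses (ia : mu.-integrable setT (EFin \o a)) (ib : mu.-integrable setT (EFin \o b))
  (aM : forall x, `|a x| <= M) (bM : forall x, `|b x| <= M).

Let ma : measurable_fun setT a.
Proof. by have /measurable_int/measurable_EFinP := ia. Qed.
Let mb : measurable_fun setT b.
Proof. by have /measurable_int/measurable_EFinP := ib. Qed.
Let mid := @measurable_id _ _ [set: R].

Lemma osc_bound_re (c s : R) x : `|cos c * a x - sin s * b x| <= M + M.
Proof.
rewrite (le_trans (ler_normB _ _))// !normrM lerD//.
  by rewrite (le_trans (ler_piMl _ (cos_max _)))//.
by rewrite (le_trans (ler_piMl _ (sin_max _)))//.
Qed.

Lemma osc_bound_im (c s : R) x : `|sin s * a x + cos c * b x| <= M + M.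
Proof.
rewrite (le_trans (ler_normD _ _))// !normrM lerD//.
  by rewrite (le_trans (ler_piMl _ (sin_max _)))//.
by rewrite (le_trans (ler_piMl _ (cos_max _)))//.
Qed.

(** The pair modulated by e^{ixy} is again bounded and integrable, and e^{ixy} e^{ix(s-y)} = e^{ixs}
    leaves the integral over [y]; the formula for the square of a plain integral therefore gives
    every [x]. *)
Lemma osc_sqr_re x :
  osc_re id a b x ^+ 2 - osc_im id a b x ^+ 2 = osc_re id (conv_re a b) (conv_im a b) x.
Proof.
rewrite /osc_re /osc_im (Rintegral_sqrB (M := M + M)); last 4 first.
- exact: integrable_osc_re.
- exact: integrable_osc_im.
- by move=> y; exact: osc_bound_re.
- by move=> y; exact: osc_bound_im.
apply: eq_Rintegral => s _ /=.
have ire := integrable_conv_re_pt ia ib aM bM s.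
have iim := integrable_conv_im_pt ia ib aM bM s.
rewrite /conv_re /conv_im -!RintegralZl// -RintegralB//; last 2 first.
- exact: (@integrableZl _ _ _ mu setT measurableT (cos (x * s)) _ ire).
- exact: (@integrableZl _ _ _ mu setT measurableT (sin (x * s)) _ iim).
apply: eq_Rintegral => y _ /=.
have -> : x * s = x * y + x * (s - y) by ring.
rewrite cosD sinD; ring.
Qed.

Lemma osc_sqr_im x :
  2 * osc_re id a b x * osc_im id a b x = osc_im id (conv_re a b) (conv_im a b) x.
Proof.
rewrite /osc_re /osc_im (Rintegral_mul2 (M := M + M)); last 4 first.
- exact: integrable_osc_re.
- exact: integrable_osc_im.
- by move=> y; exact: osc_bound_re.
- by move=> y; exact: osc_bound_im.
apply: eq_Rintegral => s _ /=.
have ire := integrable_conv_re_pt ia ib aM bM s.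
have iim := integrable_conv_im_pt ia ib aM bM s.
rewrite /conv_re /conv_im -!RintegralZl// -RintegralD//; last 2 first.
- exact: (@integrableZl _ _ _ mu setT measurableT (sin (x * s)) _ ire).
- exact: (@integrableZl _ _ _ mu setT measurableT (cos (x * s)) _ iim).
apply: eq_Rintegral => y _ /=.
have -> : x * s = x * y + x * (s - y) by ring.
rewrite cosD sinD; ring.
Qed.

(** |z|^4 = |z^2|^2: the L^4 norm in [x] becomes an L^2 norm, open to Plancherel. *)
Lemma osc_sqr_norm x :
  (osc_re id a b x ^+ 2 + osc_im id a b x ^+ 2) ^+ 2 =
  osc_re id (conv_re a b) (conv_im a b) x ^+ 2 + osc_im id (conv_re a b) (conv_im a b) x ^+ 2.
Proof. by rewrite -osc_sqr_re -osc_sqr_im; ring. Qed.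

End modulated.

End bilinear.

(** * The weighted L^4 bound in space and time *)

Section spacetime.
Context {R : realType}.
Local Notation mu := (@lebesgue_measure R).
Local Notation mu2 := (mu \x mu)%E.

Definition bracketV (x : R) := (Num.sqrt (1 + x ^+ 2))^-1.

Lemma bracket_arg_gt0 (x : R) : 0 < 1 + x ^+ 2.
Proof. by rewrite ltr_pwDl// sqr_ge0. Qed.

Lemma bracketV_gt0 (x : R) : 0 < bracketV x.
Proof. by rewrite invr_gt0 sqrtr_gt0 bracket_arg_gt0. Qed.

Lemma continuous_bracketV : continuous bracketV.
Proof.
move=> x; apply: cvgV; first by rewrite gt_eqF// sqrtr_gt0 bracket_arg_gt0.
apply: (@continuous_comp _ _ _ (fun x : R => 1 + x ^+ 2) Num.sqrt).
  by apply: cvgD; [exact: cvg_cst|exact: exprn_continuous].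
exact: sqrt_continuous.
Qed.

Lemma measurable_bracketV : measurable_fun setT bracketV.
Proof. by apply: continuous_measurable_fun; exact: continuous_bracketV. Qed.

Variables (u v : R -> R) (M : R).
Hypotheses (iu : mu.-integrable setT (EFin \o u)) (iv : mu.-integrable setT (EFin \o v))
  (uM : forall x, `|u x| <= M) (vM : forall x, `|v x| <= M).

Let mu' : measurable_fun setT u.
Proof. by have /measurable_int/measurable_EFinP := iu. Qed.
Let mv : measurable_fun setT v.
Proof. by have /measurable_int/measurable_EFinP := iv. Qed.

(** Real part of e^{itx^2} (u + iv)(x), the free evolution on the Fourier side: [x] is a frequency
    here. *)
Definition chirp_re (t x : R) := cos (t * x ^+ 2) * u x - sin (t * x ^+ 2) * v x.
Definition chirp_im (t x : R) := sin (t * x ^+ 2) * u x + cos (t * x ^+ 2) * v x.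

Let msq : measurable_fun setT (fun x : R => x ^+ 2).
Proof. exact: exprn_measurable. Qed.

Lemma integrable_chirp_re t : mu.-integrable setT (EFin \o chirp_re t).
Proof. exact: (integrable_osc_re msq iu iv t). Qed.

Lemma integrable_chirp_im t : mu.-integrable setT (EFin \o chirp_im t).
Proof. exact: (integrable_osc_im msq iu iv t). Qed.

Let cre_bound t x : `|chirp_re t x| <= M + M.
Proof. exact: osc_bound_re. Qed.

Let cim_bound t x : `|chirp_im t x| <= M + M.
Proof. exact: osc_bound_im. Qed.

Let th (s x : R) := x ^+ 2 + (s - x) ^+ 2.
Let hu (s x : R) := u x * u (s - x) - v x * v (s - x).
Let hv (s x : R) := u x * v (s - x) + v x * u (s - x).

(** The hinge of the argument. At fixed [t] the left side is a function of the frequency [s], the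
    one Plancherel in space produces; at fixed [s] the right side is an oscillatory integral in [t]
    with phase [th s], so a second L^2 bound applies to it. *)
Let conv_chirp_re t s :
  conv_re (chirp_re t) (chirp_im t) s = osc_re (th s) (hu s) (hv s) t.
Proof.
apply: eq_Rintegral => x _.
by rewrite /chirp_re /chirp_im /th /hu /hv (mulrDr t) cosD sinD; ring.
Qed.

Let conv_chirp_im t s :
  conv_im (chirp_re t) (chirp_im t) s = osc_im (th s) (hu s) (hv s) t.
Proof.
apply: eq_Rintegral => x _.
by rewrite /chirp_re /chirp_im /th /hu /hv (mulrDr t) cosD sinD; ring.
Qed.

Lemma measurable_chirp_osc : measurable_fun setT (fun p : R * R =>
  osc_re id (chirp_re p.1) (chirp_im p.1) p.2 ^+ 2 +
  osc_im id (chirp_re p.1) (chirp_im p.1) p.2 ^+ 2).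
Proof.
have mre : measurable_fun setT (fun p : R * R =>
    osc_re id (chirp_re p.1) (chirp_im p.1) p.2).
  apply: (measurable_Rintegral mu (f := fun q : (R * R) * R =>
    cos (q.1.2 * q.2) * chirp_re q.1.1 q.2 - sin (q.1.2 * q.2) * chirp_im q.1.1 q.2)).
  by rewrite /chirp_re /chirp_im; mfun.
have mim : measurable_fun setT (fun p : R * R =>
    osc_im id (chirp_re p.1) (chirp_im p.1) p.2).
  apply: (measurable_Rintegral mu (f := fun q : (R * R) * R =>
    sin (q.1.2 * q.2) * chirp_re q.1.1 q.2 + cos (q.1.2 * q.2) * chirp_im q.1.1 q.2)).
  by rewrite /chirp_re /chirp_im; mfun.
by mfun.
Qed.

Let measurable_pair : measurable_fun setT (fun p : R * R =>
  osc_re (th p.2) (hu p.2) (hv p.2) p.1 ^+ 2 + osc_im (th p.2) (hu p.2) (hv p.2) p.1 ^+ 2).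
Proof.
have mre : measurable_fun setT (fun p : R * R => osc_re (th p.2) (hu p.2) (hv p.2) p.1).
  apply: (measurable_Rintegral mu (f := fun q : (R * R) * R =>
    cos (q.1.1 * th q.1.2 q.2) * hu q.1.2 q.2 - sin (q.1.1 * th q.1.2 q.2) * hv q.1.2 q.2)).
  by rewrite /th /hu /hv; mfun.
have mim : measurable_fun setT (fun p : R * R => osc_im (th p.2) (hu p.2) (hv p.2) p.1).
  apply: (measurable_Rintegral mu (f := fun q : (R * R) * R =>
    sin (q.1.1 * th q.1.2 q.2) * hu q.1.2 q.2 + cos (q.1.1 * th q.1.2 q.2) * hv q.1.2 q.2)).
  by rewrite /th /hu /hv; mfun.
by mfun.
Qed.

Let N (x : R) := u x ^+ 2 + v x ^+ 2.

Let N0 x : 0 <= N x. Proof. by rewrite addr_ge0// sqr_ge0. Qed.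
Let mN : measurable_fun setT N. Proof. by rewrite /N; mfun. Qed.

Let w (t : R) : R := expR (- 1 * `|t|).

Let space_step t :
  (\int[mu]_x (w t * (osc_re id (chirp_re t) (chirp_im t) x ^+ 2 +
                      osc_im id (chirp_re t) (chirp_im t) x ^+ 2) ^+ 2)%:E <=
   \int[mu]_s ((2 * pi) * (w t * (osc_re (th s) (hu s) (hv s) t ^+ 2 +
                               osc_im (th s) (hu s) (hv s) t ^+ 2)))%:E)%E.
Proof.
have ire := integrable_chirp_re t; have iim := integrable_chirp_im t.
have icre := integrable_conv_re ire iim (cre_bound t) (cim_bound t).
have icim := integrable_conv_im ire iim (cre_bound t) (cim_bound t).
have mre : measurable_fun setT (conv_re (chirp_re t) (chirp_im t)).
  by have /measurable_int/measurable_EFinP := icre.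
have mim : measurable_fun setT (conv_im (chirp_re t) (chirp_im t)).
  by have /measurable_int/measurable_EFinP := icim.
have w0 : 0 <= w t by exact: expR_ge0.
have mp := measurable_osc_re (@measurable_id _ _ setT) icre icim.
have mq := measurable_osc_im (@measurable_id _ _ setT) icre icim.
under eq_integral do rewrite (osc_sqr_norm ire iim (cre_bound t) (cim_bound t)) EFinM.
rewrite ge0_integralZl ?lee_fin//; last 2 first.
  by apply/measurable_EFinP; mfun.
  by move=> x _; rewrite lee_fin addr_ge0// sqr_ge0.
apply: (@le_trans _ _ ((w t)%:E * ((2 * pi)%:E * \int[mu]_s
  (conv_re (chirp_re t) (chirp_im t) s ^+ 2 + conv_im (chirp_re t) (chirp_im t) s ^+ 2)%:E))%E).
  by rewrite lee_pmul2l ?lte_fin ?expR_gt0// plancherel_le.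
rewrite muleA -EFinM -ge0_integralZl ?lee_fin ?mulr_ge0 ?pi_ge0//; last 2 first.
  by apply/measurable_EFinP; mfun.
  by move=> x _; rewrite lee_fin addr_ge0// sqr_ge0.
rewrite le_eqVlt; apply/orP; left; apply/eqP; apply: eq_integral => s _.
by rewrite -EFinM conv_chirp_re conv_chirp_im; congr (_%:E); ring.
Qed.

(** The Schur bound in [t] with [d = 1], the parameter of the weight e^{-|t|}. The squared modulus
    of the amplitude [hu + i hv] factors as N(x) N(s - x), and the row integrals are those of
    [integral_phase_le]. *)
Let time_step s :
  (\int[mu]_t (w t * (osc_re (th s) (hu s) (hv s) t ^+ 2 +
                      osc_im (th s) (hu s) (hv s) t ^+ 2))%:E <=
   \int[mu]_x (N x * N (s - x) * (8 * pi * bracketV (2 * x - s)))%:E)%E.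
Proof.
have ihu : mu.-integrable setT (EFin \o hu s) by exact: (integrable_conv_re_pt iu iv uM vM s).
have ihv : mu.-integrable setT (EFin \o hv s) by exact: (integrable_conv_im_pt iu iv uM vM s).
have mth : measurable_fun setT (th s) by rewrite /th; mfun.
have mb := measurable_bracketV.
have mhu : measurable_fun setT (hu s) by rewrite /hu; mfun.
have mhv : measurable_fun setT (hv s) by rewrite /hv; mfun.
apply: (le_trans (integral_osc_le mth ltr01 ihu ihv)).
apply: ge0_le_integral => //.
- move=> x _; rewrite mule_ge0 ?lee_fin ?addr_ge0 ?sqr_ge0//.
  by apply: integral_ge0 => y _; rewrite lee_fin ltW// poisson_gt0.
- apply: emeasurable_funM; first by apply/measurable_EFinP; mfun.
  apply: (measurable_fun_fubini_tonelli_F (m2 := mu)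
    (fun z : R * R => (poisson 1 (th s z.1 - th s z.2))%:E)).
    by apply/measurable_EFinP; mfun.
  by move=> z; rewrite lee_fin ltW// poisson_gt0.
- by apply/measurable_EFinP; mfun.
move=> x _.
have -> : hu s x ^+ 2 + hv s x ^+ 2 = N x * N (s - x) by rewrite /hu /hv /N; ring.
rewrite (EFinM (N x * N (s - x)) (8 * pi * _)) lee_wpmul2l ?lee_fin ?mulr_ge0//.
exact: integral_phase_le.
Qed.

(** 16 pi^2 is the 2 pi of Plancherel in space times the 8 pi of the time kernel. The substitution s
    = x + y turns 2x - s into x - y and s - x into y. *)
Lemma integral_chirp_osc_le :
  (\int[mu]_t \int[mu]_x (expR (- 1 * `|t|) *
      (osc_re id (chirp_re t) (chirp_im t) x ^+ 2 +
       osc_im id (chirp_re t) (chirp_im t) x ^+ 2) ^+ 2)%:E <=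
   (16 * pi ^+ 2)%:E * \int[mu]_x \int[mu]_y
     ((u x ^+ 2 + v x ^+ 2) * (u y ^+ 2 + v y ^+ 2) * bracketV (x - y))%:E)%E.
Proof.
have m1 := measurable_chirp_osc; have m2 := measurable_pair.
have mb := measurable_bracketV.
have w0 t : 0 <= w t by exact: expR_ge0.
have mw : measurable_fun setT w by rewrite /w; mfun.
have S0 (a b : R) : 0 <= a ^+ 2 + b ^+ 2 by rewrite addr_ge0// sqr_ge0.
have b0 x : 0 <= bracketV x by rewrite ltW// bracketV_gt0.
have p0 : 0 <= 2 * pi :> R by rewrite mulr_ge0// pi_ge0.
pose f (p : R * R) := ((2 * pi) * (w p.1 * (osc_re (th p.2) (hu p.2) (hv p.2) p.1 ^+ 2 +
                               osc_im (th p.2) (hu p.2) (hv p.2) p.1 ^+ 2)))%:E.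
have mf : measurable_fun setT f by apply/measurable_EFinP; mfun.
have f0 p : (0 <= f p)%E by rewrite /f lee_fin mulr_ge0// mulr_ge0.
apply: (@le_trans _ _ (\int[mu]_t \int[mu]_s f (t, s))%E).
  apply: ge0_le_integral.
  - exact: measurableT.
  - by move=> t _; apply: integral_ge0 => x _; rewrite lee_fin mulr_ge0 ?expR_ge0// sqr_ge0.
  - apply: (measurable_fun_fubini_tonelli_F (m2 := mu) (fun p : R * R => (w p.1 *
      (osc_re id (chirp_re p.1) (chirp_im p.1) p.2 ^+ 2 +
       osc_im id (chirp_re p.1) (chirp_im p.1) p.2 ^+ 2) ^+ 2)%:E)).
      by apply/measurable_EFinP; mfun.
    by move=> p; rewrite lee_fin mulr_ge0 ?sqr_ge0.
  - exact: (measurable_fun_fubini_tonelli_F (m2 := mu) f).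
  by move=> t _; exact: space_step.
rewrite (fubini_tonelli (m1 := mu) (m2 := mu) f)//.
have c0 : 0 <= 16 * pi ^+ 2 :> R by rewrite mulr_ge0// sqr_ge0.
pose g (p : R * R) := (16 * pi ^+ 2 * (N p.2 * N (p.1 - p.2) * bracketV (2 * p.2 - p.1)))%:E.
have mg : measurable_fun setT g by apply/measurable_EFinP; mfun.
have g0 p : (0 <= g p)%E.
  by rewrite /g lee_fin mulr_ge0// mulr_ge0// mulr_ge0.
apply: (@le_trans _ _ (\int[mu]_s \int[mu]_x g (s, x))%E).
  apply: ge0_le_integral => //.
  - by move=> s _; exact: integral_ge0.
  - exact: (measurable_fun_fubini_tonelli_G (m1 := mu) f).
  - exact: (measurable_fun_fubini_tonelli_F (m2 := mu) g).
  move=> s _; rewrite /f /g /=.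
  have ms := measurable_fun_pair1 s m2; rewrite /= in ms.
  under eq_integral do rewrite EFinM.
  rewrite ge0_integralZl ?lee_fin//; last 2 first.
    by apply/measurable_EFinP; mfun.
    by move=> t _; rewrite lee_fin mulr_ge0.
  apply: (le_trans (lee_wpmul2l _ (time_step s))); first by rewrite lee_fin.
  rewrite -ge0_integralZl ?lee_fin//; last 2 first.
    by apply/measurable_EFinP; mfun.
    by move=> t _; rewrite lee_fin !mulr_ge0// pi_ge0.
  rewrite le_eqVlt; apply/orP; left; apply/eqP; apply: eq_integral => x _.
  by rewrite -EFinM; congr (_%:E); ring.
rewrite (fubini_tonelli (m1 := mu) (m2 := mu) g)//.
pose h (p : R * R) := (N p.1 * N p.2 * bracketV (p.1 - p.2))%:E.
have mh : measurable_fun setT h by apply/measurable_EFinP; mfun.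
have h0 p : (0 <= h p)%E by rewrite /h lee_fin mulr_ge0// mulr_ge0.
rewrite -ge0_integralZl ?lee_fin//; last 2 first.
- exact: (measurable_fun_fubini_tonelli_F (m2 := mu) h).
- by move=> x _; apply: integral_ge0 => y _; exact: (h0 (x, y)).
rewrite le_eqVlt; apply/orP; left; apply/eqP; apply: eq_integral => x _.
rewrite -ge0_integralZl ?lee_fin//; last 2 first.
- by apply/measurable_EFinP; mfun.
- by move=> y _; exact: (h0 (x, y)).
rewrite /fubini_G -(@ge0_integral_shift _ x (fun s => g (s, x)))//; last first.
  by rewrite /g /=; apply/measurable_EFinP; mfun.
apply: eq_integral => y _; rewrite /g /= -EFinM; congr (_%:E).
have -> : x + y - x = y by ring.
by have -> : 2 * x - (x + y) = x - y by ring.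
Qed.

End spacetime.

(** * Decay and regularity of the Fourier transform *)

Section decay.
Context {R : realType}.
Local Notation mu := (@lebesgue_measure R).

Lemma integrable_poisson : mu.-integrable setT (EFin \o (@poisson R 1)).
Proof.
apply/integrableP; split; first by apply/measurable_EFinP; mfun.
rewrite (_ : integral _ _ _ = (2 * pi)%:E) ?ltry//.
rewrite -(integral_poisson ltr01); apply: eq_integral => x _ /=.
by rewrite ger0_norm// ltW// poisson_gt0.
Qed.

Lemma le_poisson_integrable (h : R -> R) (C : R) : measurable_fun setT h ->
  (forall x, `|h x| <= C * poisson 1 x) -> mu.-integrable setT (EFin \o h).
Proof.
move=> mh hC.
have := @integrableZl _ _ _ mu setT measurableT C _ integrable_poisson.
apply: le_integrable => //; first exact/measurable_EFinP.
by move=> x _ /=; rewrite lee_fin (le_trans (hC x))// ler_norm.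
Qed.

(** The fundamental theorem of calculus on growing symmetric intervals: dominated convergence
    recovers the integral of [dG], and the boundary values vanish by the decay of [G]. Applied to a
    product, it is integration by parts without boundary terms. *)
Lemma Rintegral_derive_eq0 (G dG : R -> R) (C : R) :
  (forall x : R, is_derive x (1 : R) G (dG x)) -> continuous dG ->
  (forall x, `|G x| <= C * poisson 1 x) -> (forall x, `|dG x| <= C * poisson 1 x) ->
  \int[mu]_x dG x = 0.
Proof.
move=> GdG cdG GC dGC.
have mdG : measurable_fun setT dG by exact: continuous_measurable_fun.
have idG := le_poisson_integrable mdG dGC.
have iC := @integrableZl _ _ _ mu setT measurableT C _ integrable_poisson.
pose I n : set R := `[- n.+1%:R, n.+1%:R]%classic.
pose f_ n : R -> \bar R := (EFin \o dG) \_ (I n).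
have [|||||_ _ lim1] := @dominated_convergence _ _ _ mu setT measurableT f_
  (EFin \o dG) (fun x => C%:E * (EFin \o poisson 1) x)%E.
- move=> n.
  have mI : measurable (I n) by exact: measurable_itv.
  apply: (measurable_restrictT (EFin \o dG) mI).1.
  by apply: measurable_funTS; exact/measurable_EFinP.
- exact/measurable_EFinP.
- apply/nearW => x _; apply: cvg_near_cst.
  near=> n; rewrite /f_ patchE ifT// inE /I /= in_itv/= -ler_norml.
  rewrite (@le_trans _ _ n%:R) ?ler_nat//.
  by near: n; exact: nbhs_infty_ger.
- exact: iC.
- apply/nearW => x n _; rewrite /f_ patchE; case: ifPn => _ /=.
    by rewrite lee_fin dGC.
  by rewrite normr0 lee_fin (le_trans _ (GC x)).
have lim2 : (\int[mu]_x f_ n x)%E @[n --> \oo] --> 0%E.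
  have fE n : (\int[mu]_x f_ n x = (G n.+1%:R - G (- n.+1%:R))%:E)%E.
    rewrite /f_ -integral_mkcond (@continuous_FTC2 _ dG G)//.
    - by rewrite (@lt_trans _ _ 0)// ltrNl oppr0.
    - exact: continuous_subspaceT.
    - have cG : continuous G.
        move=> x; apply: differentiable_continuous; apply/derivable1_diffP.
        by case: (GdG x).
      split.
      + by move=> x _; case: (GdG x).
      + by apply: cvg_at_right_filter; exact: cG.
      + by apply: cvg_at_left_filter; exact: cG.
    - by move=> x _; rewrite derive1E; case: (GdG x).
  under eq_fun do rewrite fE.
  apply: cvg_EFin; first exact: nearW.
  (* Two boundary terms, each at most 2C/(n+1), because [poisson 1] is at most 2/(n+1) at n+1. *)
  have bnd n : `|G n.+1%:R - G (- n.+1%:R)| <= 4 * C * n.+1%:R^-1.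
    have C0 : 0 <= C.
      have := le_trans (normr_ge0 _) (GC 0).
      by rewrite pmulr_lge0// poisson_gt0.
    rewrite (le_trans (ler_normB _ _))//.
    have hp : poisson 1 n.+1%:R <= 2 / n.+1%:R :> R.
      rewrite /poisson expr1n mulr1 ler_pM2l// lef_pV2 ?posrE ?bracket_arg_gt0//.
      by rewrite (@le_trans _ _ (n.+1%:R ^+ 2))// ?lerDr// expr2 ler_peMr// ler1n.
    apply: (le_trans (lerD (GC _) (GC _))); rewrite poissonN.
    have -> : 4 * C * n.+1%:R^-1 = C * (2 / n.+1%:R) + C * (2 / n.+1%:R) by field.
    by rewrite lerD// ler_wpM2l.
  have h : 4 * C * n.+1%:R^-1 @[n --> \oo] --> (0 : R).
    by rewrite -[X in _ --> X](mulr0 (4 * C)); apply: cvgMr; exact: cvg_harmonic.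
  apply/cvgr0Pnorm_le => e e0; near=> n.
  apply: (le_trans (bnd n)).
  apply: le_trans (ler_norm _) _.
  by near: n; move: e e0; apply/cvgr0Pnorm_le.
by rewrite /Rintegral (cvg_unique _ lim1 lim2).
Unshelve. all: by end_near. Qed.

End decay.

(** * Cosine and sine transforms of rapidly decreasing functions *)

Section transforms.
Context {R : realType}.
Local Notation mu := (@lebesgue_measure R).

(** The Schwartz condition for one real component, so that real calculus applies to the two
    components of [f] separately. *)
Definition rapid (p : R -> R) :=
  (forall n x, derivable (derive1n n p) x 1) /\
  (forall m n : nat, exists M, forall x, `|x| ^+ m * `|derive1n n p x| <= M).

Lemma rapid_derive1 (p : R -> R) : rapid p -> rapid (derive1 p).
Proof.
move=> [dp bp]; split.
  by move=> n x; rewrite -derive1Sn; exact: dp.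
by move=> m n; have [M Mp] := bp m n.+1; exists M => x; rewrite -derive1Sn.
Qed.

Lemma rapid_derivable (p : R -> R) x : rapid p -> derivable p x 1.
Proof. by move=> [dp _]; exact: (dp 0%N). Qed.

Lemma rapid_continuous (p : R -> R) : rapid p -> continuous p.
Proof.
move=> rp x; apply: differentiable_continuous; apply/derivable1_diffP.
exact: rapid_derivable.
Qed.

Lemma rapid_measurable (p : R -> R) : rapid p -> measurable_fun setT p.
Proof. by move=> rp; apply: continuous_measurable_fun; exact: rapid_continuous. Qed.

(** The left side times 1 + x^2 is controlled by the two seminorms with exponents m and m + 2. *)
Lemma rapid_bound (p : R -> R) (m : nat) : rapid p ->
  exists C : R, 0 <= C /\ forall x, `|x| ^+ m * `|p x| <= C * poisson 1 x.
Proof.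
move=> [_ bp]; have [M0 h0] := bp m 0%N; have [M2 h2] := bp m.+2 0%N.
have M00 : 0 <= M0.
  by apply: le_trans (h0 0); rewrite mulr_ge0// exprn_ge0.
have M20 : 0 <= M2.
  by apply: le_trans (h2 0); rewrite mulr_ge0// exprn_ge0.
exists (M0 + M2); split; first by rewrite addr_ge0.
move=> x; rewrite /poisson expr1n mulr1 mulrA ler_pdivlMr ?bracket_arg_gt0//.
rewrite mulrDr mulr1.
have -> : `|x| ^+ m * `|p x| * x ^+ 2 = `|x| ^+ m.+2 * `|p x|.
  by rewrite -(real_normK (num_real x)) mulrAC -exprD addn2.
apply: (le_trans (lerD (h0 x) (h2 x))).
by rewrite ler_peMr ?addr_ge0// ler1n.
Qed.

Lemma cos_lipschitz (a b : R) : `|cos a - cos b| <= `|a - b|.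
Proof.
wlog ab : a b / b <= a.
  move=> H; have [/H //|/ltW/H] := leP b a.
  by rewrite distrC (distrC b).
have [|c _ ->] := @MVT_segment R (@cos R) (fun x => - sin x) b a ab.
- by apply: continuous_subspaceT; exact: continuous_cos.
- by rewrite normrM normrN ler_piMl// sin_max.
Qed.

Lemma sin_lipschitz (a b : R) : `|sin a - sin b| <= `|a - b|.
Proof.
wlog ab : a b / b <= a.
  move=> H; have [/H //|/ltW/H] := leP b a.
  by rewrite distrC (distrC b).
have [|c _ ->] := @MVT_segment R (@sin R) (fun x => cos x) b a ab.
- by apply: continuous_subspaceT; exact: continuous_sin.
- by rewrite normrM ler_piMl// cos_max.
Qed.

Definition cos_transform (p : R -> R) (xi : R) := \int[mu]_x (cos (x * xi) * p x).
Definition sin_transform (p : R -> R) (xi : R) := \int[mu]_x (sin (x * xi) * p x).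

Lemma rapid_integrable (p : R -> R) (h : R -> R) : rapid p ->
  measurable_fun setT h -> (forall x, `|h x| <= 1) ->
  mu.-integrable setT (EFin \o (fun x => h x * p x)).
Proof.
move=> rp mh h1; have [C [C0 hC]] := rapid_bound 0 rp.
have mp := rapid_measurable rp.
apply: (@le_poisson_integrable _ _ C); first by mfun.
move=> x; apply: le_trans (hC x).
by rewrite expr0 normrM ler_wpM2r.
Qed.

Let is_derive_scale (u x : R) : is_derive x (1 : R) (fun x : R => x * u) u.
Proof. by apply: is_derive_eq; rewrite /GRing.scale/= !(mulr1, mulr0, addr0, add0r). Qed.

Let derive_trig (T dT : R -> R) (p : R -> R) (xi x : R) : rapid p ->
  is_derive (x * xi) (1 : R) T (dT (x * xi)) ->
  is_derive x (1 : R) (fun x => T (x * xi) * p x)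
    (xi * (dT (x * xi) * p x) + T (x * xi) * derive1 p x).
Proof.
move=> rp dTT.
have HT := @is_derive1_comp _ T (fun x : R => x * xi) x _ _ dTT (is_derive_scale xi x).
have Hp : is_derive x (1 : R) p (derive1 p x).
  by rewrite derive1E; apply/derivableP; exact: rapid_derivable.
apply: is_derive_eq (is_deriveM HT Hp) _.
rewrite /GRing.scale/=; ring.
Qed.

(** Stated for a function [T] and its derivative [dT], so that the sine and the cosine share one
    proof. *)
Let trig_ibp (T dT : R -> R) (p : R -> R) (xi : R) : rapid p ->
  (forall x, is_derive x (1 : R) T (dT x)) -> continuous T -> continuous dT ->
  (forall x, `|T x| <= 1) -> (forall x, `|dT x| <= 1) ->
  xi * \int[mu]_x (dT (x * xi) * p x) = - \int[mu]_x (T (x * xi) * derive1 p x).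
Proof.
move=> rp dTT cT cdT T1 dT1; have rp' := rapid_derive1 rp.
have mT : measurable_fun setT T by exact: continuous_measurable_fun.
have mdT : measurable_fun setT dT by exact: continuous_measurable_fun.
have mTx : measurable_fun setT (fun x : R => T (x * xi)) by mfun.
have mdTx : measurable_fun setT (fun x : R => dT (x * xi)) by mfun.
have i1 := rapid_integrable rp mdTx (fun x => dT1 (x * xi)).
have i2 := rapid_integrable rp' mTx (fun x => T1 (x * xi)).
have [C0 [C00 h0]] := rapid_bound 0 rp; have [C1 [C10 h1]] := rapid_bound 0 rp'.
have cxi (S : R -> R) : continuous S -> continuous (fun x : R => S (x * xi)).
  move=> cS x; apply: (@continuous_comp _ _ _ (fun x : R => x * xi) S); last exact: cS.
  by apply: cvgMl; exact: cvg_id.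
have p0 x : 0 <= poisson 1 x :> R by rewrite ltW// poisson_gt0.
suff : \int[mu]_x (xi * (dT (x * xi) * p x) + T (x * xi) * derive1 p x) = 0.
  rewrite RintegralD//; last exact: (@integrableZl _ _ _ mu setT measurableT xi _ i1).
  by rewrite RintegralZl// => /eqP; rewrite addr_eq0 => /eqP.
apply: (@Rintegral_derive_eq0 _ (fun x => T (x * xi) * p x) _ (C0 + `|xi| * C0 + C1)).
- by move=> x; exact: derive_trig.
- move=> x; apply: cvgD.
    apply: cvgMr; apply: cvgM; first exact: cxi.
    exact: rapid_continuous.
  by apply: cvgM; [exact: cxi|exact: rapid_continuous].
- move=> x; have := h0 x; rewrite expr0 mul1r normrM => hx.
  apply: (@le_trans _ _ `|p x|); first by rewrite ler_piMl.
  by rewrite (le_trans hx)// ler_wpM2r// -addrA lerDl addr_ge0// mulr_ge0.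
- move=> x; have := h0 x; have := h1 x; rewrite !expr0 !mul1r => h1x h0x.
  rewrite (le_trans (ler_normD _ _))// !normrM.
  rewrite (@le_trans _ _ (`|xi| * `|p x| + `|derive1 p x|))//.
    rewrite lerD//; last by rewrite ler_piMl.
    by rewrite ler_wpM2l// ler_piMl.
  rewrite !mulrDl -addrA; apply: ler_wpDl; first exact: mulr_ge0.
  by apply: lerD => //; rewrite -mulrA ler_wpM2l.
Qed.

Lemma cos_transform_ibp p xi : rapid p ->
  xi * cos_transform p xi = - sin_transform (derive1 p) xi.
Proof.
move=> rp; apply: (trig_ibp (T := @sin R) (dT := @cos R)) => //.
- exact: continuous_sin.
- exact: continuous_cos.
- exact: sin_max.
- exact: cos_max.
Qed.

Lemma sin_transform_ibp p xi : rapid p ->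
  xi * sin_transform p xi = cos_transform (derive1 p) xi.
Proof.
move=> rp; apply: oppr_inj; rewrite -mulrN.
have -> : - sin_transform p xi = \int[mu]_x (- sin (x * xi) * p x).
  rewrite -mulN1r -RintegralZl//.
    by apply: eq_Rintegral => x _; rewrite mulN1r mulNr.
  by apply: rapid_integrable => //; [exact: measurable_sinM|move=> x; exact: sin_max].
apply: (trig_ibp (T := @cos R) (dT := fun x => - sin x)) => //.
- exact: continuous_cos.
- by move=> x; apply: cvgN; exact: continuous_sin.
- exact: cos_max.
- by move=> x; rewrite normrN sin_max.
Qed.

Let trig_bound (T : R -> R) (p : R -> R) : rapid p -> continuous T -> (forall x, `|T x| <= 1) ->
  forall xi, `|\int[mu]_x (T (x * xi) * p x)| <= \int[mu]_x `|p x|.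
Proof.
move=> rp cT T1 xi.
have mT : measurable_fun setT T by exact: continuous_measurable_fun.
have i1 : mu.-integrable setT (EFin \o (fun x => T (x * xi) * p x)).
  by apply: rapid_integrable => //; mfun.
have i2 : mu.-integrable setT (EFin \o p).
  have := rapid_integrable rp (measurable_cst (1 : R)) (fun x => _).
  move=> /(_ (fun x => _)) h.
  apply: eq_integrable (h _) => //; first by move=> x _ /=; rewrite mul1r.
  by move=> x; rewrite normr1.
rewrite (le_trans (le_normr_Rintegral measurableT i1))//.
apply: le_Rintegral => //; [exact: (integrable_norm i1)|exact: (integrable_norm i2)|].
by move=> x _; rewrite normrM ler_piMl.
Qed.

(** Two integrations by parts bound xi^2 times the transform by the L^1 norm of the second
    derivative. With the trivial bound this gives decay like 1/(1 + xi^2), the source of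
    integrability and boundedness on the Fourier side. *)
Lemma cos_transform_bound p : rapid p ->
  exists K, forall xi, `|cos_transform p xi| <= K * poisson 1 xi.
Proof.
move=> rp; have rp1 := rapid_derive1 rp; have rp2 := rapid_derive1 rp1.
exists ((\int[mu]_x `|p x|) + \int[mu]_x `|derive1 (derive1 p) x|) => xi.
have b0 := trig_bound rp (@continuous_cos R) (@cos_max R) xi.
have b2 := trig_bound rp2 (@continuous_cos R) (@cos_max R) xi.
rewrite -/(cos_transform _ _) in b0; rewrite -/(cos_transform _ _) in b2.
have e : xi ^+ 2 * cos_transform p xi = - cos_transform (derive1 (derive1 p)) xi.
  by rewrite expr2 -mulrA cos_transform_ibp// mulrN sin_transform_ibp.
rewrite /poisson expr1n mulr1 mulrA ler_pdivlMr ?bracket_arg_gt0//.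
have -> : `|cos_transform p xi| * (1 + xi ^+ 2) =
    `|cos_transform p xi| + `|xi ^+ 2 * cos_transform p xi|.
  by rewrite normrM (ger0_norm (sqr_ge0 _)) mulrDr mulr1 (mulrC (xi ^+ 2)).
rewrite e normrN.
rewrite (le_trans (lerD b0 b2))// ler_peMr ?ler1n//.
by rewrite addr_ge0// Rintegral_ge0.
Qed.

Lemma sin_transform_bound p : rapid p ->
  exists K, forall xi, `|sin_transform p xi| <= K * poisson 1 xi.
Proof.
move=> rp; have rp1 := rapid_derive1 rp; have rp2 := rapid_derive1 rp1.
exists ((\int[mu]_x `|p x|) + \int[mu]_x `|derive1 (derive1 p) x|) => xi.
have b0 := trig_bound rp (@continuous_sin R) (@sin_max R) xi.
have b2 := trig_bound rp2 (@continuous_sin R) (@sin_max R) xi.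
rewrite -/(sin_transform _ _) in b0; rewrite -/(sin_transform _ _) in b2.
have e : xi ^+ 2 * sin_transform p xi = - sin_transform (derive1 (derive1 p)) xi.
  by rewrite expr2 -mulrA sin_transform_ibp// cos_transform_ibp.
rewrite /poisson expr1n mulr1 mulrA ler_pdivlMr ?bracket_arg_gt0//.
have -> : `|sin_transform p xi| * (1 + xi ^+ 2) =
    `|sin_transform p xi| + `|xi ^+ 2 * sin_transform p xi|.
  by rewrite normrM (ger0_norm (sqr_ge0 _)) mulrDr mulr1 (mulrC (xi ^+ 2)).
rewrite e normrN.
rewrite (le_trans (lerD b0 b2))// ler_peMr ?ler1n//.
by rewrite addr_ge0// Rintegral_ge0.
Qed.

(** The Lipschitz constant is the first absolute moment of [p], finite by rapid decay. Lipschitz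
    control of the Fourier transform yields its measurability and, for the boxes, the increment
    bound that the lower Plancherel inequality asks for. *)
Let trig_lipschitz (T : R -> R) (p : R -> R) : rapid p -> continuous T ->
  (forall x, `|T x| <= 1) -> (forall a b, `|T a - T b| <= `|a - b|) ->
  forall xi eta, `|\int[mu]_x (T (x * xi) * p x) - \int[mu]_x (T (x * eta) * p x)| <=
    (\int[mu]_x `|x * p x|) * `|xi - eta|.
Proof.
move=> rp cT T1 TL xi eta.
have mT : measurable_fun setT T by exact: continuous_measurable_fun.
have mp := rapid_measurable rp.
have i1 z : mu.-integrable setT (EFin \o (fun x => T (x * z) * p x)).
  by apply: rapid_integrable => //; mfun.
have i2 : mu.-integrable setT (EFin \o (fun x => `|x * p x|)).
  have [C [C0 hC]] := rapid_bound 1 rp.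
  apply: (@le_poisson_integrable _ _ C); first by mfun.
  by move=> x; have := hC x; rewrite expr1 normr_id normrM.
have i3 : mu.-integrable setT (EFin \o (fun x => T (x * xi) * p x - T (x * eta) * p x)).
  exact: (@integrableB _ _ _ mu setT measurableT _ _ (i1 xi) (i1 eta)).
rewrite -RintegralB// (le_trans (le_normr_Rintegral measurableT i3))//.
rewrite -RintegralZr//; apply: le_Rintegral => //.
- exact: (integrable_norm i3).
- have := @integrableZl _ _ _ mu setT measurableT `|xi - eta| _ i2.
  by apply: eq_integrable => // x _ /=; rewrite -EFinM (mulrC `|xi - eta|).
move=> x _; rewrite -mulrBl normrM (le_trans (ler_wpM2r _ (TL _ _)))//.
by rewrite -mulrBr !normrM mulrAC.
Qed.

Lemma cos_transform_lipschitz p : rapid p -> exists K, forall xi eta,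
  `|cos_transform p xi - cos_transform p eta| <= K * `|xi - eta|.
Proof.
move=> rp; exists (\int[mu]_x `|x * p x|) => xi eta.
by apply: trig_lipschitz => //; [exact: continuous_cos|exact: cos_max|exact: cos_lipschitz].
Qed.

Lemma sin_transform_lipschitz p : rapid p -> exists K, forall xi eta,
  `|sin_transform p xi - sin_transform p eta| <= K * `|xi - eta|.
Proof.
move=> rp; exists (\int[mu]_x `|x * p x|) => xi eta.
by apply: trig_lipschitz => //; [exact: continuous_sin|exact: sin_max|exact: sin_lipschitz].
Qed.

End transforms.

(** * The Fourier transform in real components *)

Section fourier_side.
Context {R : realType}.
Local Notation mu := (@lebesgue_measure R).
Local Notation mu2 := (mu \x mu)%E.
Local Open Scope complex_scope.

Lemma cabs_sqr (z : R[i]) : cabs z ^+ 2 = complex.Re z ^+ 2 + complex.Im z ^+ 2.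
Proof.
case: z => a b; rewrite /cabs /= sqr_sqrtr//.
by rewrite addr_ge0// sqr_ge0.
Qed.

Lemma cabs_ge0 (z : R[i]) : 0 <= cabs z.
Proof. by case: z => a b; exact: sqrtr_ge0. Qed.

Lemma cabsM (z w : R[i]) : cabs (z * w) = cabs z * cabs w.
Proof. exact: ComplexField.Normc.normcM. Qed.

Lemma ReM (z w : R[i]) : complex.Re (z * w) =
  complex.Re z * complex.Re w - complex.Im z * complex.Im w.
Proof. by case: z w => [a b] [c d]. Qed.

Lemma ImM (z w : R[i]) : complex.Im (z * w) =
  complex.Re z * complex.Im w + complex.Im z * complex.Re w.
Proof. by case: z w => [a b] [c d]. Qed.

Lemma Re_le_cabs (z : R[i]) : `|complex.Re z| <= cabs z.
Proof.
rewrite -(@ler_pXn2r _ 2)// ?nnegrE ?cabs_ge0// cabs_sqr real_normK ?num_real//.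
by rewrite lerDl sqr_ge0.
Qed.

Lemma Im_le_cabs (z : R[i]) : `|complex.Im z| <= cabs z.
Proof.
rewrite -(@ler_pXn2r _ 2)// ?nnegrE ?cabs_ge0// cabs_sqr real_normK ?num_real//.
by rewrite lerDr sqr_ge0.
Qed.

Lemma schwartz_rapid (f : R -> R[i]) : schwartz f ->
  rapid (@complex.Re R \o f) /\ rapid (@complex.Im R \o f).
Proof.
move=> [sf bf]; split; split.
- by move=> n x; have [] := sf n x.
- move=> m n; have [M hM] := bf m n; exists M => x; apply: le_trans (hM x).
  by rewrite ler_wpM2l ?exprn_ge0//; exact: (Re_le_cabs (cderive1n n f x)).
- by move=> n x; have [] := sf n x.
- move=> m n; have [M hM] := bf m n; exists M => x; apply: le_trans (hM x).
  by rewrite ler_wpM2l ?exprn_ge0//; exact: (Im_le_cabs (cderive1n n f x)).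
Qed.

Lemma fourier_re (f : R -> R[i]) xi : schwartz f ->
  complex.Re (fourier f xi) =
  cos_transform (@complex.Re R \o f) xi + sin_transform (@complex.Im R \o f) xi.
Proof.
move=> /schwartz_rapid[rp rq].
rewrite /fourier /cintegral /= -RintegralD//.
- by apply: eq_Rintegral => x _; rewrite ReM /= cosN sinN mulNr opprK.
- by apply: rapid_integrable => //; [exact: measurable_cosM|move=> x; exact: cos_max].
- by apply: rapid_integrable => //; [exact: measurable_sinM|move=> x; exact: sin_max].
Qed.

Lemma fourier_im (f : R -> R[i]) xi : schwartz f ->
  complex.Im (fourier f xi) =
  cos_transform (@complex.Im R \o f) xi - sin_transform (@complex.Re R \o f) xi.
Proof.
move=> /schwartz_rapid[rp rq].
rewrite /fourier /cintegral /= -RintegralB//.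
- by apply: eq_Rintegral => x _; rewrite ImM /= cosN sinN mulNr.
- by apply: rapid_integrable => //; [exact: measurable_cosM|move=> x; exact: cos_max].
- by apply: rapid_integrable => //; [exact: measurable_sinM|move=> x; exact: sin_max].
Qed.

Lemma fourier_bound (f : R -> R[i]) : schwartz f -> exists K,
  forall xi, `|complex.Re (fourier f xi)| <= K * poisson 1 xi /\
             `|complex.Im (fourier f xi)| <= K * poisson 1 xi.
Proof.
move=> sf; have [rp rq] := schwartz_rapid sf.
have [K1 h1] := cos_transform_bound rp; have [K2 h2] := sin_transform_bound rp.
have [K3 h3] := cos_transform_bound rq; have [K4 h4] := sin_transform_bound rq.
have p0 x : 0 < poisson 1 x :> R by exact: poisson_gt0.
have pos (h : R -> R) K : (forall xi, `|h xi| <= K * poisson 1 xi) -> 0 <= K.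
  by move=> /(_ 0) /(le_trans (normr_ge0 _)); rewrite pmulr_lge0.
have := pos _ _ h1; have := pos _ _ h2; have := pos _ _ h3; have := pos _ _ h4.
move=> K40 K30 K20 K10.
exists (K1 + K2 + K3 + K4) => xi; rewrite fourier_re// fourier_im//; split.
  rewrite (le_trans (ler_normD _ _))// (le_trans (lerD (h1 _) (h4 _)))//.
  by rewrite -mulrDl; apply: ler_wpM2r; [exact: ltW|lra].
rewrite (le_trans (ler_normB _ _))// (le_trans (lerD (h3 _) (h2 _)))//.
by rewrite -mulrDl; apply: ler_wpM2r; [exact: ltW|lra].
Qed.

Lemma fourier_lipschitz (f : R -> R[i]) : schwartz f -> exists K, forall xi eta,
  `|complex.Re (fourier f xi) - complex.Re (fourier f eta)| <= K * `|xi - eta| /\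
  `|complex.Im (fourier f xi) - complex.Im (fourier f eta)| <= K * `|xi - eta|.
Proof.
move=> sf; have [rp rq] := schwartz_rapid sf.
have [K1 h1] := cos_transform_lipschitz rp; have [K2 h2] := sin_transform_lipschitz rp.
have [K3 h3] := cos_transform_lipschitz rq; have [K4 h4] := sin_transform_lipschitz rq.
have pos (h : R -> R) K : (forall xi eta, `|h xi - h eta| <= K * `|xi - eta|) -> 0 <= K.
  by move=> /(_ 1 0) /(le_trans (normr_ge0 _)); rewrite subr0 normr1 mulr1.
have := pos _ _ h1; have := pos _ _ h2; have := pos _ _ h3; have := pos _ _ h4.
move=> K40 K30 K20 K10.
exists (K1 + K2 + K3 + K4) => xi eta; rewrite !fourier_re// !fourier_im//; split.
  rewrite opprD addrACA (le_trans (ler_normD _ _))// (le_trans (lerD (h1 _ _) (h4 _ _)))//.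
  by rewrite -mulrDl; apply: ler_wpM2r; [exact: normr_ge0|lra].
have -> (a b c d : R) : a - b - (c - d) = (a - c) - (b - d) by ring.
rewrite (le_trans (ler_normB _ _))// (le_trans (lerD (h3 _ _) (h2 _ _)))//.
by rewrite -mulrDl; apply: ler_wpM2r; [exact: normr_ge0|lra].
Qed.

End fourier_side.

(** * From the propagator to the energy *)

Section propagator_side.
Context {R : realType}.
Local Notation mu := (@lebesgue_measure R).
Local Notation mu2 := (mu \x mu)%E.
Local Open Scope complex_scope.
Variable f : R -> R[i].
Hypothesis sf : schwartz f.
Let u (xi : R) := complex.Re (fourier f xi).
Let v (xi : R) := complex.Im (fourier f xi).

Lemma measurable_lipschitz (h : R -> R) (K : R) :
  (forall x y, `|h x - h y| <= K * `|x - y|) -> measurable_fun setT h.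
Proof.
move=> hK; apply: continuous_measurable_fun => x.
have K1 : 0 < `|K| + 1 by rewrite ltr_wpDl.
apply/cvgrPdist_le => e e0; near=> y.
apply: (le_trans (hK x y)).
apply: (@le_trans _ _ ((`|K| + 1) * `|x - y|)).
  by rewrite ler_wpM2r// (le_trans (ler_norm _))// lerDl.
rewrite mulrC -ler_pdivlMr//; near: y.
by apply: (@cvgr_dist_le _ _ _ _ _ id) => //; rewrite divr_gt0.
Unshelve. all: by end_near. Qed.

Let mu' : measurable_fun setT u.
Proof.
have [K h] := fourier_lipschitz sf.
by apply: (@measurable_lipschitz u K) => x y; have [] := h x y.
Qed.

Let mv : measurable_fun setT v.
Proof.
have [K h] := fourier_lipschitz sf.
by apply: (@measurable_lipschitz v K) => x y; have [] := h x y.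
Qed.

Lemma integrable_fourier : mu.-integrable setT (EFin \o u) /\ mu.-integrable setT (EFin \o v).
Proof.
have [K h] := fourier_bound sf.
by split; (apply: (@le_poisson_integrable _ _ K) => // x; have [] := h x).
Qed.

Lemma bounded_fourier : exists M, forall x, `|u x| <= M /\ `|v x| <= M.
Proof.
have [K h] := fourier_bound sf; exists (`|K| * 2) => x; have [h1 h2] := h x.
have p0 : 0 <= poisson 1 x :> R by rewrite ltW// poisson_gt0.
have H : K * poisson 1 x <= `|K| * 2.
  rewrite (le_trans (ler_wpM2r p0 (ler_norm K)))// ler_wpM2l//.
  by rewrite (le_trans (poisson_le _ _))// divr1.
by split; [exact: le_trans h1 H|exact: le_trans h2 H].
Qed.

Lemma cabs_real (c : R) : cabs c%:C = `|c|.
Proof. by rewrite /cabs /= expr0n/= addr0 sqrtr_sqr. Qed.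

(** The phase x xi + t xi^2 is split: the chirp absorbs the time part, and an oscillatory integral
    in [x] with phase [id] remains. *)
Lemma cabs_propagator t x : cabs (propagator t f x) ^+ 2 =
  (2 * pi)^-1 ^+ 2 * (osc_re id (chirp_re u v t) (chirp_im u v t) x ^+ 2 +
                      osc_im id (chirp_re u v t) (chirp_im u v t) x ^+ 2).
Proof.
rewrite /propagator cabsM exprMn cabs_real real_normK ?num_real//; congr (_ * _).
rewrite cabs_sqr; congr (_ ^+ 2 + _ ^+ 2).
  apply: eq_Rintegral => xi _.
  rewrite ReM /chirp_re /chirp_im /u /v; case: (fourier f xi) => p q /=.
  by rewrite cosD sinD; ring.
apply: eq_Rintegral => xi _.
rewrite ImM /chirp_re /chirp_im /u /v; case: (fourier f xi) => p q /=.
by rewrite cosD sinD; ring.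
Qed.

(** The quantity that links the two halves of the proof: the space-time bound ends with it and the
    box decomposition starts from it. *)
Definition energy := (\int[mu]_x \int[mu]_y
  ((u x ^+ 2 + v x ^+ 2) * (u y ^+ 2 + v y ^+ 2) * bracketV (x - y))%:E)%E.

(** On [-1,1] the indicator is at most e times e^{-|t|}. The constant is this e, times (2 pi)^{-4}
    from the definition of the propagator, times 16 pi^2. *)
Lemma spacetime_pow4_le :
  (\int[mu2]_z (`| (((fun tx : R * R => (cabs (propagator tx.1 f tx.2))%:E)
      \_ (`[(-1)%R, 1%R] `*` setT)) z) | `^ 4) <= (expR 1 / pi ^+ 2)%:E * energy)%E.
Proof.
have [M hM] := bounded_fourier; have [iu iv] := integrable_fourier.
have uM x : `|u x| <= M by have [] := hM x.
have vM x : `|v x| <= M by have [] := hM x.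
pose W (z : R * R) := osc_re id (chirp_re u v z.1) (chirp_im u v z.1) z.2 ^+ 2 +
                    osc_im id (chirp_re u v z.1) (chirp_im u v z.1) z.2 ^+ 2.
have mW : measurable_fun setT W by exact: measurable_chirp_osc.
pose c : R := (2 * pi)^-1 ^+ 4.
have c0 : 0 <= c by rewrite exprn_ge0// invr_ge0 mulr_ge0// pi_ge0.
pose I (t : R) : R := \1_(`[(-1)%R, 1%R]%classic : set R) t.
have mI : measurable_fun setT I by exact: measurable_indic.
have I01 t : 0 <= I t by rewrite /I indicE.
have -> : (\int[mu2]_z (`| (((fun tx : R * R => (cabs (propagator tx.1 f tx.2))%:E)
      \_ (`[(-1)%R, 1%R] `*` setT)) z) | `^ 4) = \int[mu2]_z (c * (I z.1 * W z ^+ 2))%:E)%E.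
  apply: eq_integral => -[t x] _; rewrite patchE /I indicE /=.
  have -> : ((t, x) \in (`[(-1)%R, 1%R] `*` setT : set (R * R))) = (t \in (`[(-1)%R, 1%R]%classic : set R)).
    by apply/idP/idP; rewrite !inE => //= -[].
  case: ifPn => _ /=.
    congr (_%:E); rewrite ger0_norm ?cabs_ge0// powR_mulrn ?cabs_ge0//.
    rewrite mul1r (_ : 4 = 2 * 2)%N// exprM cabs_propagator exprMn -exprM.
    by [].
  by rewrite normr0 mul0r mulr0 powR0.
apply: (@le_trans _ _ (\int[mu2]_z ((c * expR 1)%:E * (expR (- 1 * `|z.1|) * W z ^+ 2)%:E))%E).
  apply: ge0_le_integral.
  - exact: measurableT.
  - by move=> z _; rewrite lee_fin mulr_ge0// mulr_ge0// sqr_ge0.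
  - by apply/measurable_EFinP; mfun.
  - by apply: measurable_funeM; apply/measurable_EFinP; mfun.
  move=> [t x] _; rewrite -EFinM lee_fin -(mulrA c); apply: ler_wpM2l => //=.
  rewrite mulrA; apply: ler_wpM2r; first exact: sqr_ge0.
  rewrite /I indicE; case: (boolP (t \in _)) => [|_]; last by rewrite mulr_ge0// expR_ge0.
  rewrite inE /= in_itv/= -ler_norml => t1.
  by rewrite -expRD mulN1r -[X in X <= _]expR0 ler_expR subr_ge0.
rewrite ge0_integralZl//; last 3 first.
- by apply/measurable_EFinP; mfun.
- by move=> z _; rewrite lee_fin mulr_ge0 ?expR_ge0// sqr_ge0.
- by rewrite lee_fin mulr_ge0// expR_ge0.
have mg : measurable_fun setT (fun z : R * R => (expR (- 1 * `|z.1|) * W z ^+ 2)%:E).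
  by apply/measurable_EFinP; mfun.
have g0 (z : R * R) : (0 <= (expR (- 1 * `|z.1|) * W z ^+ 2)%:E)%E.
  by rewrite lee_fin mulr_ge0 ?expR_ge0// sqr_ge0.
rewrite (fubini_tonelli1 (m1 := mu) (m2 := mu) _ mg g0).
have cpos : (0 <= (c * expR 1)%:E)%E by rewrite lee_fin mulr_ge0// expR_ge0.
apply: (le_trans (lee_wpmul2l cpos (integral_chirp_osc_le iu iv uM vM))).
rewrite muleA -EFinM (_ : _ * _ * _ = expR 1 / pi ^+ 2)//.
have : (pi : R) != 0 by rewrite gt_eqF// pi_gt0.
by rewrite /c; move: (pi : R) => p p0; field.
Qed.

End propagator_side.

(** * Frequency boxes *)

Section window_facts.
Context {R : realType}.

(** The interval [-2,2] leaves a margin of 1 around the support: if two points are less than 1 apart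
    and one lies outside it, then [h] vanishes at both. Points at least 1 apart are settled by the
    sup bound, the remaining pairs by the mean value theorem. *)
Lemma bump_lipschitz (h : R -> R) :
  (forall x, derivable h x 1) -> (forall x, derivable (derive1 h) x 1) ->
  (forall x, 1 < `|x| -> h x = 0) ->
  exists K, forall x y, `|h x| <= K /\ `|h x - h y| <= K * `|x - y|.
Proof.
move=> dh ddh h0.
have ch : continuous h.
  by move=> x; apply: differentiable_continuous; apply/derivable1_diffP.
have cdh : continuous (derive1 h).
  by move=> x; apply: differentiable_continuous; apply/derivable1_diffP.
have le22 : - 2 <= 2 :> R by lra.
have cn (g : R -> R) : continuous g -> {within `[- 2, 2], continuous (fun x => `|g x|)}.
  move=> cg; apply: continuous_subspaceT => x.
  by apply: (@continuous_comp _ _ _ g (@Num.norm R R)); [exact: cg|exact: norm_continuous].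
have [b _ hb] := EVT_max le22 (cn h ch).
have [l _ hl] := EVT_max le22 (cn (derive1 h) cdh).
have hB x : `|h x| <= `|h b|.
  have [x2|x2] := leP `|x| 2; first by apply: hb; rewrite in_itv/= -ler_norml.
  by rewrite h0 ?normr0// (lt_trans _ x2)// ltr1n.
exists (2 * `|h b| + `|derive1 h l|) => x y.
have L0 : 0 <= `|derive1 h l| by [].
have B0 : 0 <= `|h b| by [].
split; first by have := hB x; lra.
have [xy1|xy1] := leP 1 `|x - y|.
  rewrite (le_trans (ler_normB _ _))// (le_trans (lerD (hB x) (hB y)))//.
  have H : 2 * `|h b| + `|derive1 h l| <= (2 * `|h b| + `|derive1 h l|) * `|x - y|.
    by rewrite ler_peMr// addr_ge0// mulr_ge0.
  by apply: le_trans H; lra.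
have xy0 : 0 <= `|x - y| by [].
have [|far] := boolP ((`|x| <= 2) && (`|y| <= 2)); last first.
  have xy : `|x| <= `|x - y| + `|y| by rewrite -{1}(subrK y x) ler_normD.
  have yx : `|y| <= `|x - y| + `|x| by rewrite -{1}(subrK x y) distrC ler_normD.
  move: far; rewrite negb_and -!ltNge => far.
  have x1 : 1 < `|x| by case/orP: far => ?; lra.
  have y1 : 1 < `|y| by case/orP: far => ?; lra.
  by rewrite (h0 x)// (h0 y)// subr0 normr0 mulr_ge0// addr_ge0// mulr_ge0.
move=> /andP[x2 y2].
have main a c : `|a| <= 2 -> `|c| <= 2 -> a <= c -> `|h c - h a| <= `|derive1 h l| * `|c - a|.
  move=> + + ac; rewrite (ler_norml a) (ler_norml c) => /andP[a1 a2] /andP[c1 c2].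
  have [||z] := @MVT_segment R h (derive1 h) a c ac.
  - by move=> z _; rewrite derive1E; apply/derivableP.
  - exact: continuous_subspaceT.
  rewrite in_itv/= => /andP[z1 z2] ->; rewrite normrM ler_wpM2r//.
  by apply: hl; rewrite in_itv/= (le_trans a1 z1) (le_trans z2 c2).
have H : `|h x - h y| <= `|derive1 h l| * `|x - y|.
  have [xy|/ltW xy] := leP y x; first exact: main.
  by rewrite distrC (distrC x); exact: main.
by rewrite (le_trans H)// ler_wpM2r// lerDr mulr_ge0.
Qed.

Lemma sum_le_sum_subset (T : eqType) (r s : seq T) (a : T -> R) :
  uniq r -> uniq s -> {subset r <= s} -> (forall x, 0 <= a x) ->
  \sum_(x <- r) a x <= \sum_(x <- s) a x.
Proof.
move=> ur us rs a0.
rewrite [leRHS](bigID (fun x => x \in r))/= -[leLHS]addr0 lerD//; last exact: sumr_ge0.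
rewrite -[leRHS]big_filter le_eqVlt; apply/orP; left; apply/eqP; apply: perm_big.
apply: uniq_perm => //; first exact: filter_uniq.
move=> x; rewrite mem_filter; apply/idP/andP => [xr|[]//].
by rewrite xr rs.
Qed.

Definition centered_range (n : nat) : seq int :=
  [seq (i%:Z - n%:Z)%R | i <- iota 0 (2 * n).+1].

Lemma centered_range_uniq n : uniq (centered_range n).
Proof. by rewrite map_inj_uniq ?iota_uniq// => i j /addIr [->]. Qed.

Lemma mem_centered_range n (j : int) : `|j| <= n%:Z -> j \in centered_range n.
Proof.
move=> jn; apply/mapP; exists (absz (j + n%:Z)); last by lia.
by rewrite mem_iota; lia.
Qed.

Variable phi : R -> R[i].
Hypothesis wphi : window phi.

Lemma window_eq0 x : 1 < `|x| -> phi x = 0.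
Proof.
move=> x1; apply/eqP; apply/negPn/negP => px.
have [_ + _] := wphi => /(_ x); rewrite /= in_itv/= -ler_norml leNgt x1.
by move=> H; have // : false by apply: H; apply: subset_closure.
Qed.

Lemma window_lipschitz : exists K, forall x y,
  [/\ `|complex.Re (phi x)| <= K, `|complex.Im (phi x)| <= K,
      `|complex.Re (phi x) - complex.Re (phi y)| <= K * `|x - y| &
      `|complex.Im (phi x) - complex.Im (phi y)| <= K * `|x - y|].
Proof.
have [sphi _ _] := wphi.
have [|||K1 h1] := @bump_lipschitz (@complex.Re R \o phi).
- by move=> x; exact: (sphi 0%N x).1.
- by move=> x; rewrite -derive1n1; exact: (sphi 1%N x).1.
- by move=> x hx; rewrite /comp (window_eq0 hx).
have [|||K2 h2] := @bump_lipschitz (@complex.Im R \o phi).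
- by move=> x; exact: (sphi 0%N x).2.
- by move=> x; rewrite -derive1n1; exact: (sphi 1%N x).2.
- by move=> x hx; rewrite /comp (window_eq0 hx).
have K10 : 0 <= K1 by have [/(le_trans (normr_ge0 _))] := h1 0 0.
have K20 : 0 <= K2 by have [/(le_trans (normr_ge0 _))] := h2 0 0.
exists (K1 + K2) => x y; have [a1 a2] := h1 x y; have [b1 b2] := h2 x y.
have xy0 : 0 <= `|x - y| by [].
split.
- by apply: (le_trans a1); rewrite lerDl.
- by apply: (le_trans b1); rewrite lerDr.
- by apply: (le_trans a2); rewrite ler_wpM2r// lerDl.
- by apply: (le_trans b2); rewrite ler_wpM2r// lerDr.
Qed.

(** Cauchy-Schwarz over the three translates that can be nonzero at [xi]. It replaces the positivity
    that a general window does not have. *)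
Lemma window_sum_sqr_ge (n : nat) (xi : R) : `|xi| <= n%:R ->
  1 <= 3 * \sum_(j <- centered_range n.+2) cabs (phi (xi - j%:~R)) ^+ 2.
Proof.
move=> xin; have [_ _ /(_ xi) sum1] := wphi.
pose m := Num.floor xi.
have m1 : m%:~R <= xi by exact: ge_floor.
have m2 : xi < m%:~R + 1 by rewrite -intrD1 lt_succ_floor.
(* Every j with |xi - j| <= 1 is in this list, because m <= xi < m + 1; for |xi| <= n its entries
   lie between -(n+1) and n+1. *)
pose r : seq int := [:: m - 1; m; m + 1].
have ur : uniq r by rewrite /= !inE; lia.
have sumr : \sum_(j <- r) phi (xi - j%:~R) = 1.
  rewrite -sum1 (fsbig_seq _ _ ur); apply: fsbig_widen => // j [_ /= jr].
  apply: window_eq0; rewrite ltNge; apply/negP; rewrite ler_norml => /andP[j1 j2].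
  apply: jr; rewrite !inE.
  have a1 : (j < m + 2) by rewrite -(ltr_int R) rmorphD/=; lra.
  have a2 : (m - 1 <= j) by rewrite -(ler_int R) rmorphB/=; lra.
  lia.
have rs : {subset r <= centered_range n.+2}.
  have b1 : (m <= n%:Z) by rewrite -(ler_int R); move: xin; rewrite ler_norml => /andP[_]; lra.
  have b2 : (- n%:Z - 1 < m).
    by rewrite -(ltr_int R) rmorphB/= rmorphN/=; move: xin; rewrite ler_norml => /andP[+ _]; lra.
  by move=> j; rewrite !inE => /or3P[] /eqP ->; apply: mem_centered_range; lia.
have sq0 (j : int) : 0 <= cabs (phi (xi - j%:~R)) ^+ 2 by exact: sqr_ge0.
have := sum_le_sum_subset ur (centered_range_uniq n.+2) rs sq0.
move=> H; apply: (le_trans _ (ler_wpM2l _ H)) => //.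
move: sumr; rewrite /r !big_cons !big_nil !addr0 !cabs_sqr.
move: (phi _) (phi _) (phi _) => [a1 b1] [a2 b2] [a3 b3] [] /= e _.
(* The real parts sum to 1, and (a1 + a2 + a3)^2 <= 3 (a1^2 + a2^2 + a3^2). *)
rewrite [leLHS](_ : 1 = (a3 + (a2 + a1)) ^+ 2); last by rewrite e expr1n.
have := sqr_ge0 b1; have := sqr_ge0 b2; have := sqr_ge0 b3.
have := sqr_ge0 (a1 - a2); have := sqr_ge0 (a2 - a3); have := sqr_ge0 (a1 - a3).
lra.
Qed.

End window_facts.

Section box_side.
Context {R : realType}.
Local Notation mu := (@lebesgue_measure R).
Local Open Scope complex_scope.
Variables (phi f : R -> R[i]).
Hypotheses (wphi : window phi) (sf : schwartz f).

Let u (k : int) (xi : R) := complex.Re (phi (xi - k%:~R) * fourier f xi).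
Let v (k : int) (xi : R) := complex.Im (phi (xi - k%:~R) * fourier f xi).

Lemma cabs_box k x : cabs (box phi k f x) ^+ 2 =
  (2 * pi)^-1 ^+ 2 * (osc_re id (u k) (v k) x ^+ 2 + osc_im id (u k) (v k) x ^+ 2).
Proof.
rewrite /box /inv_fourier cabsM exprMn cabs_real real_normK ?num_real//; congr (_ * _).
rewrite cabs_sqr; congr (_ ^+ 2 + _ ^+ 2).
  apply: eq_Rintegral => xi _; rewrite ReM /u /v.
  by case: (phi _ * fourier f xi) => p q.
apply: eq_Rintegral => xi _; rewrite ImM /u /v.
by case: (phi _ * fourier f xi) => p q /=; rewrite addrC.
Qed.

Lemma box_uv_sqr k xi : u k xi ^+ 2 + v k xi ^+ 2 =
  cabs (phi (xi - k%:~R)) ^+ 2 *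
    (complex.Re (fourier f xi) ^+ 2 + complex.Im (fourier f xi) ^+ 2).
Proof. by rewrite -!cabs_sqr cabsM exprMn. Qed.

(** Decay and Lipschitz bounds pass from the window and the Fourier transform to their product; they
    are the input of [plancherel_ge]. *)
Lemma box_uv_props k : exists B L, [/\
  (forall xi, `|u k xi| <= B * poisson 1 xi /\ `|v k xi| <= B * poisson 1 xi),
  (forall xi eta, `|u k xi - u k eta| <= L * `|xi - eta| /\
                  `|v k xi - v k eta| <= L * `|xi - eta|), 0 <= B & 0 <= L].
Proof.
have [K hK] := window_lipschitz wphi.
have [G hG] := fourier_bound sf; have [L hL] := fourier_lipschitz sf.
have [M hM] := bounded_fourier sf.
have K0 : 0 <= K by have [/(le_trans (normr_ge0 _))] := hK 0 0.
have M0 : 0 <= M by have [/(le_trans (normr_ge0 _))] := hM 0.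
have G0 : 0 <= G.
  by have [/(le_trans (normr_ge0 _)) + _] := hG 0; rewrite pmulr_lge0// poisson_gt0.
have L0 : 0 <= L.
  by have [/(le_trans (normr_ge0 _)) + _] := hL 1 0; rewrite subr0 normr1 mulr1.
exists (2 * (K * G)), (2 * (K * L + M * K)); split.
- move=> xi; have [a1 a2 _ _] := hK (xi - k%:~R) 0; have [g1 g2] := hG xi.
  have -> : 2 * (K * G) * poisson 1 xi =
    K * (G * poisson 1 xi) + K * (G * poisson 1 xi) by ring.
  rewrite /u /v ReM ImM; split.
    by rewrite (le_trans (ler_normB _ _))// !normrM lerD// ler_pM.
  by rewrite (le_trans (ler_normD _ _))// !normrM lerD// ler_pM.
- move=> xi eta.
  have [a1 a2 a3 a4] := hK (xi - k%:~R) (eta - k%:~R).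
  have [g1 g2] := hL xi eta; have [m1 m2] := hM eta.
  have e : xi - k%:~R - (eta - k%:~R) = xi - eta by ring.
  rewrite e in a3 a4.
  have d0 : 0 <= `|xi - eta| by [].
  have prod (p p' q q' : R) : `|p| <= K -> `|p - p'| <= K * `|xi - eta| ->
      `|q - q'| <= L * `|xi - eta| -> `|q'| <= M ->
      `|p * q - p' * q'| <= (K * L + M * K) * `|xi - eta|.
    move=> h1 h2 h3 h4.
    have -> : p * q - p' * q' = p * (q - q') + q' * (p - p') by ring.
    rewrite (le_trans (ler_normD _ _))// !normrM mulrDl -!mulrA.
    by rewrite lerD// ler_pM.
  have -> : 2 * (K * L + M * K) * `|xi - eta| =
    (K * L + M * K) * `|xi - eta| + (K * L + M * K) * `|xi - eta| by ring.
  rewrite /u /v !ReM !ImM; split.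
    have -> (a b c d : R) : a - b - (c - d) = (a - c) - (b - d) by ring.
    by rewrite (le_trans (ler_normB _ _))// lerD// prod.
  have -> (a b c d : R) : a + b - (c + d) = (a - c) + (b - d) by ring.
  by rewrite (le_trans (ler_normD _ _))// lerD// prod.
- by rewrite !mulr_ge0.
- by rewrite mulr_ge0// addr_ge0// mulr_ge0.
Qed.

Lemma box_uv_eq0 k xi : 1 < `|xi - k%:~R| -> u k xi = 0 /\ v k xi = 0.
Proof. by move=> /(window_eq0 wphi) h; rewrite /u /v h mul0r. Qed.

Lemma integrable_box_sqr k :
  mu.-integrable setT (EFin \o (fun xi => u k xi ^+ 2 + v k xi ^+ 2)).
Proof.
have [B [L [hB hL B0 L0]]] := box_uv_props k.
have mU : measurable_fun setT (u k).
  by apply: (@measurable_lipschitz _ _ L) => x y; have [] := hL x y.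
have mV : measurable_fun setT (v k).
  by apply: (@measurable_lipschitz _ _ L) => x y; have [] := hL x y.
have p0 x : 0 <= poisson 1 x :> R by rewrite ltW// poisson_gt0.
have B2 x : B * poisson 1 x <= 2 * B.
  by rewrite mulrC ler_wpM2r// (le_trans (poisson_le _ _))// divr1.
have u2 x : `|u k x| <= 2 * B by have [h _] := hB x; exact: le_trans h (B2 x).
have v2 x : `|v k x| <= 2 * B by have [_ h] := hB x; exact: le_trans h (B2 x).
apply: (@le_poisson_integrable _ _ (4 * B ^+ 2)); first by mfun.
move=> x; have [h1 h2] := hB x.
rewrite ger0_norm ?addr_ge0 ?sqr_ge0//.
have -> : 4 * B ^+ 2 * poisson 1 x = 2 * B * (B * poisson 1 x) + 2 * B * (B * poisson 1 x).
  by ring.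
rewrite -(real_normK (num_real (u k x))) -(real_normK (num_real (v k x))) !expr2.
by rewrite lerD// ler_pM.
Qed.

Lemma box_norm_ge k :
  (\int[mu]_xi (cabs (phi (xi - k%:~R)) ^+ 2 *
      (complex.Re (fourier f xi) ^+ 2 + complex.Im (fourier f xi) ^+ 2))%:E <=
   (2 * pi)%:E * Lnorm mu 2%:E (fun x => (cabs (box phi k f x))%:E) `^ 2)%E.
Proof.
have [B [L [hB hL B0 L0]]] := box_uv_props k.
have mU : measurable_fun setT (u k).
  by apply: (@measurable_lipschitz _ _ L) => x y; have [] := hL x y.
have mV : measurable_fun setT (v k).
  by apply: (@measurable_lipschitz _ _ L) => x y; have [] := hL x y.
have iu : mu.-integrable setT (EFin \o u k).
  by apply: (@le_poisson_integrable _ _ B) => // x; have [] := hB x.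
have iv : mu.-integrable setT (EFin \o v k).
  by apply: (@le_poisson_integrable _ _ B) => // x; have [] := hB x.
have p0 x : 0 <= poisson 1 x :> R by rewrite ltW// poisson_gt0.
have B2 x : B * poisson 1 x <= 2 * B.
  by rewrite mulrC ler_wpM2r// (le_trans (poisson_le _ _))// divr1.
have u2 x : `|u k x| <= 2 * B by have [h _] := hB x; exact: le_trans h (B2 x).
have v2 x : `|v k x| <= 2 * B by have [_ h] := hB x; exact: le_trans h (B2 x).
have inn := integrable_box_sqr k.
pose c (x : R) : R := \1_(`[k%:~R - 1, k%:~R + 1]%classic : set R) x.
have c0 x : 0 <= c x by rewrite /c indicE.
have ic : mu.-integrable setT (EFin \o c) by exact: integrable_indic_itv.
(* Let A be the squared increment and t = s - r. The Lipschitz bounds give A <= 2 L^2 t^2, the sizes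
   of the components give A <= 2 (4B)^2 = 32 B^2. The first bound plus t^2 times the second is A (1
   + t^2) <= (2 L^2 + 32 B^2) t^2. *)
have M0 : 0 <= 2 * L ^+ 2 + 32 * B ^+ 2.
  by rewrite addr_ge0// mulr_ge0// sqr_ge0.
have key s r : (u k s - u k r) ^+ 2 + (v k s - v k r) ^+ 2 <=
    (2 * L ^+ 2 + 32 * B ^+ 2) * (c s + c r) * ((s - r) ^+ 2 / (1 + (s - r) ^+ 2)).
  have q0 : 0 <= (s - r) ^+ 2 / (1 + (s - r) ^+ 2).
    by rewrite divr_ge0 ?sqr_ge0// ltW// bracket_arg_gt0.
  have cI x : 1 < `|x - k%:~R| \/ c x = 1.
    have [h|h] := ltP 1 `|x - k%:~R|; [by left|right].
    rewrite /c indicE mem_set//= in_itv/=.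
    by move: h; rewrite ler_norml => /andP[h1 h2]; apply/andP; split; lra.
  (* Either both points lie outside the support of the box and the increment is 0, or one of them
     lies in the interval of radius 1 around k and [c s + c r] is at least 1. *)
  have [[hs hr]|cc] : (1 < `|s - k%:~R| /\ 1 < `|r - k%:~R|) \/ 1 <= c s + c r.
    case: (cI s) => [hs|->]; last by right; rewrite lerDl.
    by case: (cI r) => [hr|->]; [left|right; rewrite lerDr].
    have [-> ->] := box_uv_eq0 hs; have [-> ->] := box_uv_eq0 hr.
    by rewrite !subrr expr0n/= addr0 mulr_ge0// mulr_ge0// addr_ge0.
  apply: (@le_trans _ _ ((2 * L ^+ 2 + 32 * B ^+ 2) * ((s - r) ^+ 2 / (1 + (s - r) ^+ 2)))).
    have [h1 h2] := hL s r.
    have sq (a b : R) : `|a| <= b -> a ^+ 2 <= b ^+ 2.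
      by move=> ab; rewrite -(real_normK (num_real a)) ler_sqr ?nnegrE// (le_trans _ ab).
    have e1 := sq _ _ h1; have e2 := sq _ _ h2.
    rewrite exprMn real_normK ?num_real// in e1 e2.
    have f1 : (u k s - u k r) ^+ 2 <= (4 * B) ^+ 2.
      apply: sq; rewrite (le_trans (ler_normB _ _))// (le_trans (lerD (u2 _) (u2 _)))//.
      by rewrite -mulrDl; apply: ler_wpM2r => //; lra.
    have f2 : (v k s - v k r) ^+ 2 <= (4 * B) ^+ 2.
      apply: sq; rewrite (le_trans (ler_normB _ _))// (le_trans (lerD (v2 _) (v2 _)))//.
      by rewrite -mulrDl; apply: ler_wpM2r => //; lra.
    rewrite mulrA ler_pdivlMr ?bracket_arg_gt0//.
    have t0 := sqr_ge0 (s - r).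
    have f3 : (u k s - u k r) ^+ 2 + (v k s - v k r) ^+ 2 <= 32 * B ^+ 2 by lra.
    have f4 := ler_wpM2r t0 f3.
    rewrite [leLHS]mulrDr mulr1; lra.
  rewrite ler_wpM2r// ler_peMr//.
have := plancherel_ge iu iv inn ic c0 M0 key.
under eq_integral do rewrite box_uv_sqr.
move=> H.
have mre := measurable_osc_re (@measurable_id _ _ setT) iu iv.
have mim := measurable_osc_im (@measurable_id _ _ setT) iu iv.
have pp : 0 < (2 * pi : R) by rewrite mulr_gt0// pi_gt0.
have LE : (Lnorm mu 2%:E (fun x => (cabs (box phi k f x))%:E) `^ 2 =
   ((2 * pi)^-1 ^+ 2)%:E * \int[mu]_x (osc_re id (u k) (v k) x ^+ 2 + osc_im id (u k) (v k) x ^+ 2)%:E)%E.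
  rewrite poweR_Lnorm// -ge0_integralZl//; last 3 first.
  - by apply/measurable_EFinP; mfun.
  - by move=> x _; rewrite lee_fin addr_ge0// sqr_ge0.
  - by rewrite lee_fin exprn_ge0// invr_ge0 ltW.
  apply: eq_integral => x _; rewrite -EFinM -cabs_box /= ger0_norm ?cabs_ge0//.
  by rewrite powR_mulrn ?cabs_ge0.
rewrite LE muleA -EFinM.
have -> : 2 * pi * (2 * pi)^-1 ^+ 2 = (2 * pi)^-1 :> R.
  by move: pp; move: (2 * pi : R) => p pp; field; rewrite gt_eqF.
by rewrite -lee_pdivlMl// in H *; rewrite ?invr_gt0.
Qed.

End box_side.

(** * Schur's test and the conclusion *)

Section schur.
Context {R : realType}.

(** The mean value theorem for x^{-s}. The right-hand sides telescope, which sums the series with an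
    explicit constant of order 1/s. *)
Lemma powR_telescope (s : R) (n : nat) : 0 < s -> (0 < n)%N ->
  n.+1%:R `^ (- (1 + s)) <= s^-1 * (n%:R `^ (- s) - n.+1%:R `^ (- s)) :> R.
Proof.
move=> s0 n0.
have n0' : 0 < n%:R :> R by rewrite ltr0n.
have nn : n%:R <= n.+1%:R :> R by rewrite ler_nat.
have d (x : R) : 0 < x -> is_derive x (1 : R) (@powR R ^~ (- s)) (- s * x `^ (- s - 1)).
  by move=> x0; exact: is_derive1_powR.
have [||c] := @MVT_segment R (@powR R ^~ (- s)) (fun x => - s * x `^ (- s - 1)) _ _ nn.
- by move=> x; rewrite in_itv/= => /andP[nx _]; apply: d; exact: lt_trans nx.
- apply: derivable_within_continuous => x; rewrite in_itv/= => /andP[nx _].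
  by have [] := d x (lt_le_trans n0' nx).
rewrite in_itv/= => /andP[nc cn] E.
have c0 : 0 < c by exact: lt_le_trans nc.
have -> : n%:R `^ (- s) - n.+1%:R `^ (- s) = s * c `^ (- s - 1).
  rewrite -opprB E (_ : n.+1%:R - n%:R = 1) ?mulr1 ?mulNr ?opprK//.
  by rewrite -natr1 addrAC subrr add0r.
rewrite mulrA mulVf ?gt_eqF// mul1r.
have -> : - (1 + s) = - s - 1 by ring.
have -> : - s - 1 = - (s + 1) by ring.
rewrite !powRN lef_pV2 ?posrE ?powR_gt0//.
by apply: ge0_ler_powR; rewrite ?nnegrE ?(ltW c0)// ltW// addr_gt0.
Qed.

Definition bracket (j : int) : R := japanese_bracket j.

Lemma bracket_ge1 j : 1 <= bracket j.
Proof.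
by rewrite /bracket /japanese_bracket -[leLHS]sqrtr1 ler_wsqrtr// lerDl sqr_ge0.
Qed.

Lemma bracket_gt0 j : 0 < bracket j.
Proof. exact: lt_le_trans (bracket_ge1 j). Qed.

Lemma bracket_ge_abs j : (absz j)%:R <= bracket j.
Proof.
rewrite /bracket /japanese_bracket -(@ler_pXn2r _ 2)// ?nnegrE// sqr_sqrtr; last first.
  by rewrite addr_ge0// sqr_ge0.
have -> : (absz j)%:R ^+ 2 = j%:~R ^+ 2 :> R.
  by rewrite -[RHS](real_normK (num_real _)) -intr_norm -abszE.
by rewrite lerDr.
Qed.

(** Majorant of <j>^{-(1+s)} as a function of n = |j|: 1 for n = 0 and n = 1, a telescoping
    difference from n = 2 on. Its total is at most 2 + 1/s. *)
Let b (s : R) (n : nat) : R :=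
  if (n <= 1)%N then 1 else s^-1 * (n.-1%:R `^ (- s) - n%:R `^ (- s)).

Let b_ge0 s n : 0 < s -> 0 <= b s n.
Proof.
move=> s0; rewrite /b; case: leqP => // n1.
case: n n1 => [//|[//|n]] _ /=.
by rewrite (le_trans _ (powR_telescope s0 (ltn0Sn n)))// powR_ge0.
Qed.

Let bracket_powR_le s j : 0 < s -> bracket j `^ (- (1 + s)) <= b s (absz j).
Proof.
move=> s0; rewrite /b; case: leqP => j1.
  rewrite powRN invf_le1 ?powR_gt0 ?bracket_gt0//.
  rewrite -[leLHS](powRr0 (bracket j)) ler_powR ?bracket_ge1//.
  by rewrite addr_ge0// ltW.
have := bracket_ge_abs j; move: (absz j) j1 => [//|[//|n]] _ /= nj.
apply: le_trans (powR_telescope s0 (ltn0Sn n)).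
rewrite !powRN lef_pV2 ?posrE ?powR_gt0 ?bracket_gt0//.
by apply: ge0_ler_powR; rewrite ?nnegrE ?(ltW (bracket_gt0 _))// ltW// addr_gt0.
Qed.

Let sum_b s N : 0 < s -> \sum_(0 <= n < N) b s n <= 2 + s^-1.
Proof.
move=> s0.
have H n : \sum_(0 <= n < n.+2) b s n = 2 + s^-1 * (1 - n.+1%:R `^ (- s)).
  elim: n => [|n ih].
    by rewrite !big_nat_recr//= big_geq// /b/= powR1 subrr mulr0 add0r addr0.
  by rewrite big_nat_recr//= ih /b/=; ring.
have le1 n : 2 + s^-1 * (1 - n.+1%:R `^ (- s)) <= 2 + s^-1.
  by rewrite lerD2l ler_piMr ?invr_ge0 ?ltW// gerBl powR_ge0.
apply: le_trans (le1 N); rewrite -H [leRHS](@big_cat_nat _ _ _ N)//=; last by rewrite ltnW.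
by rewrite lerDl sumr_ge0// => n _; exact: b_ge0.
Qed.

Let sum_b_uniq s (t : seq nat) : 0 < s -> uniq t -> \sum_(n <- t) b s n <= 2 + s^-1.
Proof.
move=> s0 ut; apply: le_trans (sum_b (\max_(n <- t) n).+1 s0).
apply: sum_le_sum_subset => //; first exact: iota_uniq.
  move=> n nt; rewrite mem_index_iota /= ltnS.
  exact: leq_bigmax_seq.
by move=> n; exact: b_ge0.
Qed.

(** Nonnegative and negative indices are summed separately, since |j| is injective on each; hence
    the factor 2. The bound is uniform over duplicate-free lists, so it also covers the image of [t]
    under l -> j - l. *)
Lemma sum_bracket_powR (s : R) (t : seq int) : 0 < s -> uniq t ->
  \sum_(j <- t) bracket j `^ (- (1 + s)) <= 2 * (2 + s^-1).
Proof.
move=> s0 ut; rewrite (bigID (fun j : int => 0 <= j))/= -[X in X + _]big_filter -[X in _ + X]big_filter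
  mulr2n mulrDl mul1r.
have part (P : pred int) : {in P &, injective absz} ->
    \sum_(j <- [seq j <- t | P j]) bracket j `^ (- (1 + s)) <= 2 + s^-1.
  move=> Pinj; apply: (@le_trans _ _ (\sum_(j <- [seq j <- t | P j]) b s (absz j))).
    by apply: ler_sum => j _; exact: bracket_powR_le.
  rewrite -(big_map absz xpredT (b s)); apply: sum_b_uniq => //.
  rewrite map_inj_in_uniq ?filter_uniq// => i j; rewrite !mem_filter => /andP[Pi _] /andP[Pj _].
  exact: Pinj.
by apply: lerD; apply: part => -[i|i] [j|j] //= _ _ e; congr (_ _); lia.
Qed.

(** With B_j = <j>^{2e} beta_j the kernel becomes <j - l>^{-1} p_j p_l, where p_j = <j>^{-2e}. In
    each half of B_j B_l <= (B_j^2 + B_l^2)/2 one of the weights is bounded by 1 and the other makes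
    the row summable. A row sum is at most twice 2 (2 + 1/(2e)), that is 8 + 2/e. *)
Lemma schur_bound (e : R) (t : seq int) (beta : int -> R) : 0 < e -> uniq t ->
  (forall j, 0 <= beta j) ->
  \sum_(j <- t) \sum_(l <- t) (bracket (j - l))^-1 * (beta j * beta l) <=
  8 * (1 + e^-1) * \sum_(j <- t) bracket j `^ (4 * e) * beta j ^+ 2.
Proof.
move=> e0 ut beta0.
pose p (j : int) : R := bracket j `^ (- (2 * e)).
pose B (j : int) : R := bracket j `^ (2 * e) * beta j.
pose V (j l : int) : R := (bracket (j - l))^-1.
have V0 j l : 0 < V j l by rewrite invr_gt0 bracket_gt0.
have VC j l : V j l = V l j.
  by rewrite /V /bracket /japanese_bracket -opprB rmorphN sqrrN.
have p0 j : 0 < p j by rewrite powR_gt0 ?bracket_gt0.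
have p1 j : p j <= 1.
  rewrite /p powRN invf_le1 ?powR_gt0 ?bracket_gt0//.
  by rewrite -[leLHS](powRr0 (bracket j)) ler_powR ?bracket_ge1// mulr_ge0// ltW.
have betaE j : beta j = p j * B j.
  by rewrite /p /B powRN mulrA mulVf ?mul1r// gt_eqF// powR_gt0 ?bracket_gt0.
have B2 j : B j ^+ 2 = bracket j `^ (4 * e) * beta j ^+ 2.
  rewrite exprMn; congr (_ * _).
  have -> : 4 * e = 2 * e + 2 * e by ring.
  by rewrite expr2 powRD// (gt_eqF (bracket_gt0 j)) implybT.
have two_e : 0 < 2 * e by rewrite mulr_gt0.
(* The smaller bracket takes all the decay: if <j - l> <= <l> then <l>^{-2e} <= <j - l>^{-2e}, and
   otherwise <j - l>^{-1} <= <l>^{-1}. *)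
have Vp j l : V j l * p l <=
    bracket (j - l) `^ (- (1 + 2 * e)) + bracket l `^ (- (1 + 2 * e)).
  have w k : bracket k `^ (- (1 + 2 * e)) = (bracket k)^-1 * bracket k `^ (- (2 * e)).
    rewrite opprD powRD ?powR_inv1 ?ltW ?bracket_gt0//.
    by apply/implyP => _; rewrite gt_eqF// bracket_gt0.
  have [h|h] := leP (bracket (j - l)) (bracket l).
    rewrite -[leLHS]addr0 lerD ?powR_ge0// w /V /p ler_wpM2l ?invr_ge0 ?(ltW (bracket_gt0 _))//.
    rewrite !powRN lef_pV2 ?posrE ?powR_gt0 ?bracket_gt0//.
    by apply: ge0_ler_powR; rewrite ?nnegrE ?(ltW (bracket_gt0 _))// ltW.
  rewrite -[leLHS]add0r lerD ?powR_ge0// w /V /p ler_wpM2r ?powR_ge0//.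
  by rewrite lef_pV2 ?posrE ?bracket_gt0// ltW.
have row j : \sum_(l <- t) V j l * p l <= 8 * (1 + e^-1).
  apply: (le_trans (ler_sum _ (fun l _ => Vp j l))); rewrite big_split/=.
  have Z1 := sum_bracket_powR two_e ut.
  have Z2 : \sum_(l <- t) bracket (j - l) `^ (- (1 + 2 * e)) <= 2 * (2 + (2 * e)^-1).
    rewrite -(big_map (fun l => j - l) xpredT (fun k => bracket k `^ (- (1 + 2 * e)))).
    by apply: sum_bracket_powR => //; rewrite map_inj_uniq// => a c /addrI/oppr_inj.
  apply: (le_trans (lerD Z2 Z1)).
  have -> : (2 * e)^-1 = 2^-1 * e^-1 :> R by field; rewrite gt_eqF.
  have : 0 < e^-1 by rewrite invr_gt0.
  by lra.
have term j l : V j l * (beta j * beta l) <=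
    2^-1 * (B j ^+ 2 * (V j l * p l)) + 2^-1 * (B l ^+ 2 * (V l j * p j)).
  have -> : V j l * (beta j * beta l) = V j l * (p j * p l) * (B j * B l).
    by rewrite !betaE; ring.
  have q0 : 0 <= V j l * (p j * p l) by rewrite ltW// !mulr_gt0.
  have h1 : B j * B l <= 2^-1 * B j ^+ 2 + 2^-1 * B l ^+ 2.
    by have := sqr_ge0 (B j - B l); lra.
  apply: (le_trans (ler_wpM2l q0 h1)); rewrite mulrDr (VC l j).
  apply: lerD.
    have -> : V j l * (p j * p l) * (2^-1 * B j ^+ 2) =
      p j * (2^-1 * (B j ^+ 2 * (V j l * p l))) by ring.
    rewrite ler_piMl//; apply: mulr_ge0; first by rewrite invr_ge0.
    by rewrite mulr_ge0 ?sqr_ge0// mulr_ge0// ltW.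
  have -> : V j l * (p j * p l) * (2^-1 * B l ^+ 2) =
    p l * (2^-1 * (B l ^+ 2 * (V j l * p j))) by ring.
  rewrite ler_piMl//; apply: mulr_ge0; first by rewrite invr_ge0.
  by rewrite mulr_ge0 ?sqr_ge0// mulr_ge0// ltW.
apply: (@le_trans _ _ (\sum_(j <- t) \sum_(l <- t)
  (2^-1 * (B j ^+ 2 * (V j l * p l)) + 2^-1 * (B l ^+ 2 * (V l j * p j))))).
  by apply: ler_sum => j _; apply: ler_sum => l _; exact: term.
under eq_bigr do rewrite big_split/=.
rewrite big_split/= [X in _ + X]exchange_big/= -mulr2n -[leLHS]mulr_natl.
rewrite mulr_sumr mulr_sumr; apply: ler_sum => j _.
rewrite -!mulr_sumr -B2; set S := \sum_(_ <- _) _.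
have -> : 2%:R * (2^-1 * (B j ^+ 2 * S)) = S * B j ^+ 2 by field.
by rewrite ler_wpM2r ?sqr_ge0// row.
Qed.

End schur.

(** * Decomposition of the energy into boxes *)

Section energy_bound.
Context {R : realType}.
Local Notation mu := (@lebesgue_measure R).
Local Notation mu2 := (mu \x mu)%E.
Variables (phi f : R -> R[i]).
Hypotheses (wphi : window phi) (sf : schwartz f).

Let N (xi : R) := complex.Re (fourier f xi) ^+ 2 + complex.Im (fourier f xi) ^+ 2.
Let B (j : int) (xi : R) := cabs (phi (xi - j%:~R)) ^+ 2 * N xi.

Let N_ge0 xi : 0 <= N xi. Proof. by rewrite addr_ge0 ?sqr_ge0. Qed.
Let B_ge0 j xi : 0 <= B j xi. Proof. by rewrite mulr_ge0 ?sqr_ge0. Qed.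

Definition box_mass (j : int) : R := \int[mu]_xi B j xi.

Lemma box_mass_ge0 j : 0 <= box_mass j.
Proof. by apply: Rintegral_ge0 => xi _; exact: B_ge0. Qed.

Let integrable_B j : mu.-integrable setT (EFin \o B j).
Proof.
have -> : B j = fun xi => complex.Re (phi (xi - j%:~R) * fourier f xi) ^+ 2 +
    complex.Im (phi (xi - j%:~R) * fourier f xi) ^+ 2.
  by apply/funext => xi; rewrite box_uv_sqr.
exact: integrable_box_sqr.
Qed.

Lemma EFin_box_mass j : ((box_mass j)%:E = \int[mu]_xi (B j xi)%:E)%E.
Proof. by rewrite EFin_Rintegral//; exact: integrable_B. Qed.

(** 1 + k^2 <= 9 (1 + w^2) as soon as |w - k| <= 2. The tolerance 2 is the sum of the radii of two
    boxes. *)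
Lemma bracketV_le (x y : R) (k : int) : `|x - y - k%:~R| <= 2 ->
  bracketV (x - y) <= 3 * (bracket k)^-1.
Proof.
move: (x - y) => w; rewrite ler_norml => /andP[w1 w2].
rewrite ler_pdivlMr ?bracket_gt0// mulrC ler_pdivrMr ?sqrtr_gt0 ?bracket_arg_gt0//.
rewrite -(@ler_pXn2r _ 2)// ?nnegrE ?mulr_ge0 ?sqrtr_ge0// exprMn.
rewrite !sqr_sqrtr ?(ltW (bracket_arg_gt0 _))//.
by have := sqr_ge0 w; have := sqr_ge0 (k%:~R - 2 * w); nra.
Qed.

(** 27 = 3 * 3 * 3: the overlap bound of the window at [x] and at [y], and the passage from x - y to
    j - l. When these two differ by more than 2, one of the box factors is 0. *)
Lemma energy_density_le (n : nat) (x y : R) : `|x| <= n%:R -> `|y| <= n%:R ->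
  N x * N y * bracketV (x - y) <=
  27 * \sum_(j <- centered_range n.+2) \sum_(l <- centered_range n.+2)
    (bracket (j - l))^-1 * (B j x * B l y).
Proof.
move=> xn yn; set r := centered_range _.
have sN (t : R) : `|t| <= n%:R -> N t <= 3 * \sum_(j <- r) B j t.
  move=> /(window_sum_sqr_ge wphi) /(ler_wpM2l (N_ge0 t)); rewrite mulr1 => /le_trans; apply.
  by rewrite mulrCA ler_wpM2l// mulr_sumr; apply: ler_sum => j _; rewrite mulrC.
have V0 : 0 <= bracketV (x - y) by rewrite ltW// bracketV_gt0.
apply: (@le_trans _ _ (3 * (\sum_(j <- r) B j x) * (3 * \sum_(l <- r) B l y) * bracketV (x - y))).
  by rewrite ler_wpM2r// ler_pM// sN.
have -> : 3 * (\sum_(j <- r) B j x) * (3 * \sum_(l <- r) B l y) * bracketV (x - y) =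
    9 * (\sum_(j <- r) \sum_(l <- r) bracketV (x - y) * (B j x * B l y)).
  rewrite [in RHS](eq_bigr (fun j => bracketV (x - y) * (B j x * \sum_(l <- r) B l y))).
    by rewrite -[in RHS]mulr_sumr -[in RHS]mulr_suml; ring.
  by move=> j _; rewrite -mulr_sumr -mulr_sumr.
have -> : 27 = 9 * 3 :> R by ring.
rewrite -mulrA ler_wpM2l// mulr_sumr; apply: ler_sum => j _.
rewrite mulr_sumr; apply: ler_sum => l _; rewrite mulrA.
have BB0 : 0 <= B j x * B l y by rewrite mulr_ge0.
have [|h] := leP `|x - y - (j - l)%:~R| 2.
  by move=> /bracketV_le; exact: ler_wpM2r.
have c0 : cabs (0 : R[i]) = 0 by rewrite /cabs ComplexField.Normc.normc0.
suff -> : B j x * B l y = 0 by rewrite !mulr0.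
have [xj|xj] := ltP 1 `|x - j%:~R|.
  by rewrite /B (window_eq0 wphi xj) c0 expr0n !mul0r.
have [yl|yl] := ltP 1 `|y - l%:~R|.
  by rewrite /B (window_eq0 wphi yl) c0 expr0n mul0r mulr0.
exfalso; move: h; apply/negP; rewrite -leNgt.
have -> : x - y - (j - l)%:~R = (x - j%:~R) - (y - l%:~R) by rewrite rmorphB/=; ring.
by rewrite (le_trans (ler_normB _ _))//; lra.
Qed.

Let h (z : R * R) := N z.1 * N z.2 * bracketV (z.1 - z.2).
Let F (n : nat) : set (R * R) := `[- n%:R, n%:R] `*` `[- n%:R, n%:R].

Let measurable_N : measurable_fun setT N.
Proof.
have [iu iv] := integrable_fourier sf.
have mU := measurable_int mu iu; have mV := measurable_int mu iv.
move/measurable_EFinP in mU; move/measurable_EFinP in mV.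
by rewrite /N; mfun.
Qed.

Let measurable_h : measurable_fun setT h.
Proof. by rewrite /h; have mb := @measurable_bracketV R; have mN := measurable_N; mfun. Qed.

Let h_ge0 z : (0 <= (h z)%:E)%E.
Proof. by rewrite lee_fin mulr_ge0 ?(ltW (bracketV_gt0 _))// mulr_ge0. Qed.

Let g (j l : int) (z : R * R) : \bar R :=
  ((27 * (bracket (j - l))^-1)%:E * (B j z.1 * B l z.2)%:E)%E.

Let measurable_g j l : measurable_fun setT (g j l).
Proof.
by apply: measurable_funeM; apply: (measurable_int mu2); exact: integrable_prod.
Qed.

Let c_ge0 k : 0 <= 27 * (bracket k)^-1 :> R.
Proof. by rewrite mulr_ge0// invr_ge0 ltW// bracket_gt0. Qed.

Let g_ge0 j l z : (0 <= g j l z)%E.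
Proof. by rewrite mule_ge0// lee_fin// mulr_ge0. Qed.

Let integral_g j l : (\int[mu2]_z g j l z =
  (27 * (bracket (j - l))^-1 * (box_mass j * box_mass l))%:E)%E.
Proof.
have ip := integrable_prod (integrable_B j) (integrable_B l).
rewrite ge0_integralZl//; last 3 first.
- exact: (measurable_int mu2).
- by move=> z _; rewrite lee_fin mulr_ge0.
- by rewrite lee_fin.
by rewrite -(EFin_Rintegral ip) -Rintegral_prod// -EFinM.
Qed.

Let integral_box_le (n : nat) : (\int[mu2]_(z in F n) (h z)%:E <=
  (27 * \sum_(j <- centered_range n.+2) \sum_(l <- centered_range n.+2)
    (bracket (j - l))^-1 * (box_mass j * box_mass l))%:E)%E.
Proof.
set r := centered_range _.
have mF : measurable (F n) by apply: measurableX; exact: measurable_itv.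
have ms (j : int) : measurable_fun setT (fun z => \sum_(l <- r) g j l z)%E.
  exact: emeasurable_sum.
have s0 (j : int) z : (0 <= \sum_(l <- r) g j l z)%E by exact: sume_ge0.
have mss : measurable_fun setT (fun z => \sum_(j <- r) \sum_(l <- r) g j l z)%E.
  exact: emeasurable_sum.
have ss0 z : (0 <= \sum_(j <- r) \sum_(l <- r) g j l z)%E by exact: sume_ge0.
apply: (@le_trans _ _ (\int[mu2]_(z in F n) \sum_(j <- r) \sum_(l <- r) g j l z)%E).
  apply: ge0_le_integral => //.
  - by apply: measurable_funTS; exact/measurable_EFinP.
  - exact: measurable_funTS.
  move=> [x y] [/=]; rewrite !in_itv/= -!ler_norml => xn yn.
  rewrite (le_trans _ (_ : (27 * \sum_(j <- r) \sum_(l <- r)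
    (bracket (j - l))^-1 * (B j x * B l y))%:E <= _)%E)//.
    by rewrite lee_fin; exact: energy_density_le.
  rewrite mulr_sumr -sumEFin; apply: lee_sum => j _.
  rewrite mulr_sumr -sumEFin; apply: lee_sum => l _.
  by rewrite mulrA EFinM.
apply: (@le_trans _ _ (\int[mu2]_z \sum_(j <- r) \sum_(l <- r) g j l z)%E).
  by apply: ge0_subset_integral.
rewrite (ge0_integral_sum mu2 measurableT ms (fun j z _ => s0 j z)).
rewrite mulr_sumr -sumEFin; apply: lee_sum => j _.
rewrite (ge0_integral_sum mu2 measurableT (measurable_g j) (fun l z _ => g_ge0 j l z)).
rewrite mulr_sumr -sumEFin; apply: lee_sum => l _.
by rewrite integral_g mulrA.
Qed.

(** Exhaustion by the squares [-n,n]^2, on each of which finitely many boxes are enough; monotone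
    convergence keeps a bound uniform in n. *)
Lemma energy_le (C : \bar R) :
  (forall n, (27 * \sum_(j <- centered_range n) \sum_(l <- centered_range n)
    (bracket (j - l))^-1 * (box_mass j * box_mass l))%:E <= C)%E ->
  (energy f <= C)%E.
Proof.
move=> leC.
have mh : measurable_fun setT (EFin \o h) by exact/measurable_EFinP.
have -> : energy f = (\int[mu2]_z (EFin \o h) z)%E.
  have h0 z : (0 <= (EFin \o h) z)%E by exact: h_ge0.
  by rewrite (fubini_tonelli1 (m1 := mu) (m2 := mu) _ mh h0).
have FT : \bigcup_n F n = setT.
  apply/seteqP; split => // -[x y] _.
  exists (Num.trunc (Num.max `|x| `|y|)).+1 => //.
  split; rewrite /= in_itv/= -ler_norml ltW// (le_lt_trans _ (truncnS_gt _))//.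
    by rewrite le_max lexx.
  by rewrite le_max lexx orbT.
rewrite -FT.
have ndF : nondecreasing_seq F.
  move=> m n mn; apply/subsetPset => -[x y] [/=]; rewrite !in_itv/= -!ler_norml => xm ym.
  have mn' : m%:R <= n%:R :> R by rewrite ler_nat.
  by split; rewrite /= in_itv/= -ler_norml (le_trans _ mn').
have mF n : measurable (F n) by apply: measurableX; exact: measurable_itv.
have H : (\int[mu2]_(z in F n) (EFin \o h) z @[n --> \oo] -->
    \int[mu2]_(z in \bigcup_n F n) (EFin \o h) z)%E.
  apply: ge0_nondecreasing_set_cvg_integral => // n; first exact: measurable_funTS.
  by move=> z _; exact: h_ge0.
rewrite -(cvg_lim (@ereal_hausdorff R) H).
apply: lime_le; first by apply/cvg_ex; eexists; exact: H.
by near=> n; rewrite (le_trans (integral_box_le n)).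
Unshelve. all: by end_near. Qed.

End energy_bound.

(** * The embedding of l^q into l^4 *)

Section counting_norm.
Context {R : realType}.

Lemma le_poweR2r (x y : \bar R) (r : R) : (0 < r)%R -> (0 <= x)%E -> (0 <= y)%E ->
  (x `^ r <= y `^ r)%E -> (x <= y)%E.
Proof.
move=> r0 x0 y0 h.
have e (z : \bar R) : (0 <= z)%E -> z = ((z `^ r) `^ r^-1)%E.
  by move=> z0; rewrite -poweRrM divff ?gt_eqF// poweRe1.
rewrite (e x)// (e y)//; apply: gt0_ler_poweR => //; first by rewrite invr_ge0 ltW.
- by rewrite in_itv/= poweR_ge0 leey.
- by rewrite in_itv/= poweR_ge0 leey.
Qed.

Variables (q m : R).
Hypotheses (q1 : 1 <= q) (q4 : q < 4).

Let q0 : 0 < q. Proof. exact: lt_le_trans q1. Qed.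

Lemma lnormZ_ge0 (a : int -> \bar R) : (0 <= lnormZ q%:E a)%E.
Proof. exact: poweR_ge0. Qed.

Lemma sum_poweR_le (a : int -> \bar R) (t : seq int) :
  uniq t -> (\sum_(k <- t) `|a k| `^ q <= lnormZ q%:E a `^ q)%E.
Proof.
move=> ut; rewrite /lnormZ -poweRrM mulVf ?gt_eqF// poweRe1; last first.
  by apply: esum_ge0 => k _; exact: poweR_ge0.
by apply: esum_ge; exists [set` t]; [by split => //; exact: finite_seq|rewrite -fsbig_seq].
Qed.

Lemma le_lnormZ (a : int -> \bar R) k : (`|a k| <= lnormZ q%:E a)%E.
Proof.
apply: (le_poweR2r q0) => //; first exact: lnormZ_ge0.
by have := @sum_poweR_le a [:: k] isT; rewrite big_seq1.
Qed.

(** Every term is at most the norm [m], so a_k^4 = a_k^q a_k^{4-q} <= a_k^q m^{4-q}, and summing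
    gives m^4 with constant 1 for every [q]. This is where [q] below 4 enters. *)
Lemma sum_pow4_le (a : int -> R) (t : seq int) : (forall k, 0 <= a k) -> uniq t ->
  lnormZ q%:E (EFin \o a) = m%:E -> \sum_(k <- t) a k ^+ 4 <= m ^+ 4.
Proof.
move=> a0 ut am.
have am_le k : a k <= m.
  by have := le_lnormZ (EFin \o a) k; rewrite am lee_fin ger0_norm.
have m0 : 0 <= m by rewrite (le_trans (a0 0)).
have sum_le : \sum_(k <- t) a k `^ q <= m `^ q.
  have := sum_poweR_le (EFin \o a) ut; rewrite am /= -lee_fin -sumEFin.
  by under eq_bigr do rewrite ger0_norm//.
have split4 (x : R) : 0 <= x -> x ^+ 4 = x `^ q * x `^ (4 - q).
  (* At x = 0 the law of exponents needs a nonzero total exponent; here the total is 4. *)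
  move=> x0; rewrite -powRD; first by rewrite addrC subrK powR_mulrn.
  by rewrite addrC subrK pnatr_eq0.
have q4' : 0 <= 4 - q by rewrite subr_ge0 ltW.
apply: (@le_trans _ _ (\sum_(k <- t) a k `^ q * m `^ (4 - q))).
  apply: ler_sum => k _; rewrite split4// ler_wpM2l ?powR_ge0//.
  by apply: ge0_ler_powR; rewrite ?nnegrE.
by rewrite -mulr_suml split4// ler_wpM2r ?powR_ge0.
Qed.

End counting_norm.

(** * The estimate for one Schwartz function *)

Section strichartz.
Context {R : realType}.
Local Notation mu := (@lebesgue_measure R).
Variables (phi f : R -> R[i]).
Hypotheses (wphi : window phi) (sf : schwartz f).
Variables (eps q : R).
Hypotheses (e0 : 0 < eps) (q1 : 1 <= q) (q4 : q < 4).

Let gam (k : int) : \bar R := Lnorm mu 2%:E (fun x => (cabs (box phi k f x))%:E).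

(** 864 = 27 * 8 * 4: the box decomposition, Schur's test, and the square of the bound of a box mass
    by 2 pi times the squared norm of the box. The weight <k>^{4 eps} left by Schur's test is the
    fourth power of the modulation weight. *)
Lemma energy_le_modulation (m : R) : modulation_norm phi eps 2%:E q%:E f = m%:E ->
  (energy f <= (864 * (1 + eps^-1) * pi ^+ 2 * m ^+ 4)%:E)%E.
Proof.
move=> mE.
have b1 k : 1 <= bracket k `^ eps :> R.
  by rewrite -(powRr0 (bracket k)) ler_powR ?bracket_ge1// ltW.
have gam0 k : (0 <= gam k)%E by exact: Lnorm_ge0.
pose a (k : int) := ((bracket k `^ eps)%:E * gam k)%E.
have aE : lnormZ q%:E a = m%:E by exact: mE.
(* The weight is at least 1, so a finite modulation norm dominates the norm of every box. *)
have gam_fin k : gam k = (fine (gam k))%:E.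
  rewrite fineK// ge0_fin_numE// (@le_lt_trans _ _ m%:E) ?ltry//.
  rewrite -aE (le_trans _ (le_lnormZ q1 a k))// gee0_abs ?mule_ge0 ?lee_fin ?powR_ge0//.
  by rewrite -[leLHS]mul1e lee_wpmul2r// lee_fin.
pose c k := fine (gam k).
have c0 k : 0 <= c k by exact: fine_ge0.
pose al k := bracket k `^ eps * c k.
have alE : lnormZ q%:E (EFin \o al) = m%:E.
  by rewrite -aE; congr lnormZ; apply/funext => k; rewrite /a gam_fin.
have al0 k : 0 <= al k by rewrite mulr_ge0 ?powR_ge0.
have pi0 : 0 <= (pi : R) by exact: pi_ge0.
have mass k : box_mass phi f k <= 2 * pi * c k ^+ 2.
  have := box_norm_ge wphi sf k; rewrite -/(gam k) gam_fin poweR_EFin powR_mulrn; last exact: c0.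
  by rewrite -EFin_box_mass// -EFinM lee_fin mulrA.
apply: (energy_le wphi sf) => n; rewrite lee_fin.
have ut := centered_range_uniq n.
have S := schur_bound e0 ut (box_mass_ge0 phi f).
have m4 := sum_pow4_le q1 q4 al0 ut alE.
apply: (le_trans (ler_wpM2l _ S)) => //.
have e1 : 0 <= 8 * (1 + eps^-1) by rewrite mulr_ge0// addr_ge0// invr_ge0 ltW.
have h : \sum_(j <- centered_range n) bracket j `^ (4 * eps) * box_mass phi f j ^+ 2 <=
    4 * pi ^+ 2 * m ^+ 4.
  apply: (@le_trans _ _ (4 * pi ^+ 2 * \sum_(k <- centered_range n) al k ^+ 4)).
    rewrite mulr_sumr; apply: ler_sum => k _.
    have -> : bracket k `^ (4 * eps) = (bracket k `^ eps) ^+ 4 :> R.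
      by rewrite -powR_mulrn ?powR_ge0// -powRrM mulrC.
    rewrite /al exprMn [leRHS]mulrCA ler_wpM2l ?exprn_ge0 ?powR_ge0//.
    have -> : 4 * pi ^+ 2 * c k ^+ 4 = (2 * pi * c k ^+ 2) ^+ 2 by ring.
    by rewrite ler_sqr ?nnegrE ?box_mass_ge0// mulr_ge0 ?sqr_ge0// mulr_ge0.
  by rewrite ler_wpM2l// mulr_ge0// sqr_ge0.
have -> : 864 * (1 + eps^-1) * pi ^+ 2 * m ^+ 4 =
  27 * (8 * (1 + eps^-1) * (4 * pi ^+ 2 * m ^+ 4)) by ring.
by rewrite ler_wpM2l// ler_wpM2l.
Qed.

Lemma spacetime_norm_le :
  (spacetime_norm 4%:E (fun t x => propagator t f x) <=
   ((864 * expR 1 * (1 + eps^-1)) `^ 4^-1)%:E * modulation_norm phi eps 2%:E q%:E f)%E.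
Proof.
set K := 864 * expR 1 * (1 + eps^-1).
have K0 : 0 < K.
  apply: mulr_gt0; last by rewrite addr_gt0// invr_gt0.
  by apply: mulr_gt0; [rewrite ltr0n|exact: expR_gt0].
have C0 : 0 < K `^ 4^-1 by rewrite powR_gt0.
have M0 : (0 <= modulation_norm phi eps 2%:E q%:E f)%E by exact: lnormZ_ge0.
(* If the modulation norm is infinite, so is the right-hand side, because the constant is
   positive. *)
case mE : (modulation_norm phi eps 2%:E q%:E f) M0 => [m| |]//; last first.
  by move=> _; rewrite gt0_muley ?leey// lte_fin.
rewrite lee_fin => m0.
have four : 0 < (4 : R) by [].
apply: (le_poweR2r four); first exact: Lnorm_ge0.
  by rewrite mule_ge0// lee_fin// ltW.
rewrite poweR_Lnorm; last by rewrite gt_eqF.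
apply: (le_trans (spacetime_pow4_le sf)).
have pi0 : 0 < (pi : R) by exact: pi_gt0.
have c0 : (0 <= (expR 1 / pi ^+ 2 : R)%:E)%E.
  by rewrite lee_fin divr_ge0 ?expR_ge0 ?sqr_ge0.
apply: (le_trans (lee_wpmul2l c0 (energy_le_modulation mE))).
rewrite -!EFinM poweR_EFin lee_fin.
rewrite powR_mulrn ?mulr_ge0 ?powR_ge0// exprMn -[X in _ <= X * _]powR_mulrn ?powR_ge0//.
rewrite -powRrM mulVf// (powRr1 (ltW K0)).
rewrite /K le_eqVlt; apply/orP; left; apply/eqP.
by move: (pi : R) pi0 => p p0; field; rewrite !gt_eqF.
Qed.

End strichartz.

(** The witness is a function of [eps] alone, which is what allows it to be fixed before [q] and
    [f]; it grows like eps^{-1/4} as [eps] tends to 0. *)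
Theorem theorem2 (R : realType) (phi : R -> R[i]) (phi_window : window phi)
    (eps : R) (eps_gt0 : 0 < eps) :
  exists C : R, 0 < C /\
    forall (q : R) (f : R -> R[i]), 1 <= q < 4 -> schwartz f ->
      (spacetime_norm 4%:E (fun t x => propagator t f x)
        <= C%:E * modulation_norm phi eps 2%:E q%:E f)%E.
Proof.
exists ((864 * expR 1 * (1 + eps^-1)) `^ 4^-1); split.
  apply: powR_gt0; apply: mulr_gt0; last by rewrite addr_gt0// invr_gt0.
  by apply: mulr_gt0; [rewrite ltr0n|exact: expR_gt0].
by move=> q f /andP[q1 q4] sf; exact: spacetime_norm_le.
Qed.
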